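(* Let $A$ be a noetherian AS Gorenstein algebra of type $(d,\mathfrak l)$, let $\xi\le1$ be a real number, and let $M\ne0$ be a finitely generated graded left $A$-module with finite projective dimension. (1) Let $w$ be an integer with $0\le w\le d$. Then $$\max_{0\le j\le w}\{\deg H^j_{\mathfrak m}(M)+\xi j\}=-\mathfrak l+\xi d+\max_{d-w\le j\le d}\{\deg\mathrm{Tor}^A_j(k,M)-\xi j\}.$$ (2) In particular, if $w$ is chosen to be maximal with the property that $H^w_{\mathfrak m}(M)\ne0$, then $$\operatorname{CMreg}_\xi(M)=-\mathfrak l+\xi d+\max_{d-w\le j\le d}\{\deg\mathrm{Tor}^A_j(k,M)-\xi j\}.$$ (3) If, further, $M$ is $s$-Cohen--Macaulay, then $p:=d-s$ is the projective dimension of $M$ and $$\operatorname{CMreg}_\xi(M)=-\mathfrak l+\xi s+\deg(\mathrm{Tor}^A_p(k,M)).$$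
   Context: $k$ is a field. A connected graded algebra is an $\mathbb{N}$-graded $k$-algebra $A=\bigoplus_{i\ge 0}A_i$ with $A_0=k$; put $\mathfrak m=A_{\ge1}$ and let $k$ also denote the graded $A$-bimodule $A/\mathfrak m$. Noetherian means left and right noetherian. $M(\ell)_m=M_{m+\ell}$ for a graded module $M$. For a $\mathbb{Z}$-graded vector space $M$, $\deg(M)=\sup\{j\mid M_j\ne0\}$, with $\deg(0)=-\infty$ (so maxima are taken in $\mathbb{R}\cup\{\pm\infty\}$). A connected graded algebra $T$ is Artin--Schelter (AS) Gorenstein of type $(d,\mathfrak l)$ if (a) $T$ has injective dimension $d<\infty$ on the left and on the right; (b) $\mathrm{Ext}^i_T({}_Tk,{}_TT)=\mathrm{Ext}^i_T(k_T,T_T)=0$ for all $i\ne d$; (c) $\mathrm{Ext}^d_T({}_Tk,{}_TT)\cong\mathrm{Ext}^d_T(k_T,T_T)\cong k(\mathfrak l)$ for some integer $\mathfrak l$. Local cohomology: $H^i_{\mathfrak m}(M)=\varinjlim_n \mathrm{Ext}^i_A(A/A_{\ge n},M)$. A finitely generated graded left $A$-module $M$ is $s$-Cohen--Macaulay if $H^i_{\mathfrak m}(M)=0$ for all $i\ne s$ and $H^s_{\mathfrak m}(M)\ne0$. For $\xi\in\mathbb{R}$, $\operatorname{CMreg}_\xi(M)=\sup_{i,j\in\mathbb Z}\{j+\xi i\mid H^i_{\mathfrak m}(M)_j\ne 0\}$. *)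

(* Defs.v *)
From HB Require Import structures.
From mathcomp Require Import all_boot all_order all_algebra.
From mathcomp Require Import all_classical all_reals all_analysis.

Set Implicit Arguments.
Unset Strict Implicit.
Unset Printing Implicit Defensive.

Import Order.TTheory GRing.Theory Num.Theory.

Local Open Scope classical_set_scope.
Local Open Scope ring_scope.

(* Sums of elements taken from the pieces [g i] with [i] in [D]. *)
Definition gsum (V : zmodType) (g : int -> set V) (D : set int) : set V :=
  [set x | exists (s : seq int) (f : int -> V),
     (forall i, i \in s -> D i /\ g i (f i)) /\ x = \sum_(i <- s) f i].

(* V is the direct sum of the additive subgroups [g i]. *)
Record direct_sum (V : zmodType) (g : int -> set V) : Prop := DirectSum {
  ds0 : forall i, g i 0;
  dsB : forall i x y, g i x -> g i y -> g i (x - y);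
  ds_span : gsum g setT = setT;
  ds_free : forall (s : seq int) (f : int -> V), uniq s ->
    (forall i, g i (f i)) -> \sum_(i <- s) f i = 0 ->
    forall i, i \in s -> f i = 0 }.

Lemma big_sub_uniq (V : zmodType) (r t : seq int) (F : int -> V) :
  uniq r -> uniq t -> {subset t <= r} ->
  \sum_(i <- r) (if i \in t then F i else 0) = \sum_(i <- t) F i.
Proof.
move=> ur ut tr; rewrite -big_mkcond -big_filter; apply: perm_big.
apply: uniq_perm => //; first exact: filter_uniq.
by move=> i; rewrite mem_filter; case it: (i \in t) => //=; apply: tr.
Qed.

Section DirectSum.
Variables (V : zmodType) (g : int -> set V).
Hypothesis gds : direct_sum g.

Lemma dsN i x : g i x -> g i (- x).
Proof. by move=> gx; rewrite -sub0r; apply: dsB => //; apply: ds0. Qed.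

Lemma dsD i x y : g i x -> g i y -> g i (x + y).
Proof. by move=> gx gy; rewrite -[y]opprK; apply: dsB => //; apply: dsN. Qed.

Lemma gsum_uniq D x : gsum g D x -> exists (s : seq int) (f : int -> V),
  [/\ uniq s, forall i, g i (f i), forall i, i \in s -> D i
    & x = \sum_(i <- s) f i].
Proof.
move=> [s [f [sf ->]]]; exists (undup s).
exists (fun i => if i \in s then f i *+ count_mem i s else 0).
split; first exact: undup_uniq.
- move=> i; case: ifP => [/sf[_ gi]|_]; last exact: ds0.
  elim: (count_mem i s) => [|m IH]; first by rewrite mulr0n; apply: ds0.
  by rewrite mulrS; apply: dsD.
- by move=> i; rewrite mem_undup => /sf[].
rewrite -big_undup_iterop_count; apply: eq_big_seq => i.
by rewrite mem_undup => ->; rewrite Monoid.iteropE iter_addr addr0.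
Qed.

Lemma gsum_sep (D : set int) (s : seq int) (f : int -> V) :
  uniq s -> (forall i, g i (f i)) -> gsum g D (\sum_(i <- s) f i) ->
  forall i, i \in s -> ~ D i -> f i = 0.
Proof.
move=> us gf /gsum_uniq[t [h [ut gh tD e]]] i si nDi.
pose r := undup (s ++ t); have ur : uniq r by apply: undup_uniq.
pose F j := (if j \in s then f j else 0) - (if j \in t then h j else 0).
have gF j : g j (F j) by apply: dsB => //; case: ifP => // _; apply: ds0.
have F0 : \sum_(j <- r) F j = 0.
  rewrite /F sumrB big_sub_uniq ?big_sub_uniq ?e ?subrr //.
  - by move=> j jt; rewrite mem_undup mem_cat jt orbT.
  - by move=> j js; rewrite mem_undup mem_cat js.
have /(ds_free gds ur gF F0) : i \in r by rewrite mem_undup mem_cat si.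
rewrite /F si; case: ifP => [/tD//|_]; by rewrite subr0.
Qed.

Lemma gsum0 D : gsum g D 0.
Proof. by exists [::], (fun=> 0); split => //; rewrite big_nil. Qed.

Lemma gsum1 (D : set int) i x : D i -> g i x -> gsum g D x.
Proof.
move=> Di gx; exists [:: i], (fun=> x); rewrite big_seq1; split => // j.
by rewrite inE => /eqP ->.
Qed.

Lemma gsumD D x y : gsum g D x -> gsum g D y -> gsum g D (x + y).
Proof.
move=> /gsum_uniq[s [f [us gf sD ->]]] /gsum_uniq[t [h [ut gh tD ->]]].
exists (undup (s ++ t)).
exists (fun j => (if j \in s then f j else 0) + (if j \in t then h j else 0)).
split.
  move=> j; rewrite mem_undup mem_cat => jst; split.
    by case/orP: jst => [/sD|/tD].
  by apply: dsD; case: ifP => // _; apply: ds0.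
rewrite big_split /= !big_sub_uniq ?undup_uniq //.
- by move=> j jt; rewrite mem_undup mem_cat jt orbT.
- by move=> j js; rewrite mem_undup mem_cat js.
Qed.

Lemma gsumN D x : gsum g D x -> gsum g D (- x).
Proof.
move=> [s [f [sf ->]]]; exists s, (fun i => - f i); rewrite sumrN.
by split => // i /sf[Di gi]; split => //; apply: dsN.
Qed.

Lemma gsum_sum D (J : Type) (r : seq J) (P : pred J) (F : J -> V) :
  (forall j, P j -> gsum g D (F j)) -> gsum g D (\sum_(j <- r | P j) F j).
Proof.
by move=> h; elim/big_ind: _ => //; [exact: gsum0|exact: gsumD].
Qed.

End DirectSum.

(* An N-graded ring, written as a Z-graded ring with zero negative part. *)
Record grRing := GrRing {
  gr_sort :> nzRingType;
  grR : int -> set gr_sort;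
  grR_ds : direct_sum grR;
  grR_neg : forall i x, i < 0 -> grR i x -> x = 0;
  grR_1 : grR 0 1;
  grR_M : forall i j x y, grR i x -> grR j y -> grR (i + j) (x * y) }.

(* The opposite graded ring: graded left modules over [grop B] are the graded
   right B-modules, with [a *: x] standing for x.a *)
Section Opposite.
Variable B : grRing.

Let convM i j (x y : B^c) :
  grR i (x : B) -> grR j (y : B) -> grR (i + j) (x * y : B).
Proof. by move=> Bx By; rewrite addrC; apply: (@grR_M B j i y x). Qed.

Definition grop : grRing :=
  @GrRing B^c (@grR B) (grR_ds B) (@grR_neg B) (grR_1 B) convM.

End Opposite.

Record grMod (B : grRing) := GrMod {
  gm_sort :> lmodType B;
  grM : int -> set gm_sort;
  grM_ds : direct_sum grM;
  grM_Z : forall i j (a : B) (x : gm_sort),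
    grR i a -> grM j x -> grM (i + j) (a *: x) }.

(* The pieces are k-subspaces because they are stable under A_0 = k. *)
Record cgAlg (k : fieldType) := CgAlg {
  cg_sort :> algType k;
  grA : int -> set cg_sort;
  grA_ds : direct_sum grA;
  grA_neg : forall i x, i < 0 -> grA i x -> x = 0;
  grA_M : forall i j x y, grA i x -> grA j y -> grA (i + j) (x * y);
  grA_0 : grA 0 = [set c%:A | c in [set: k]] }.

Section Sides.
Variables (k : fieldType) (A : cgAlg k).

Let grA_1 : grA 0 (1 : A).
Proof. by rewrite grA_0; exists 1 => //; rewrite scale1r. Qed.

Definition lring : grRing :=
  @GrRing A (@grA k A) (grA_ds A) (@grA_neg k A) grA_1 (@grA_M k A).

Definition rring : grRing := grop lring.

End Sides.

Section Truncation.
Variables (B : grRing) (n : nat).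

(* B as a graded left module over itself. *)
Definition regular : grMod B := @GrMod B B^o (@grR B) (grR_ds B) (@grR_M B).

(* The ideal B_{>=n}. *)
Definition tail : set B := gsum (@grR B) [set i | n%:Z <= i].

Lemma tail_zmod : zmod_closed [pred x : B | `[< tail x >]].
Proof.
have ds := grR_ds B; split=> [|x y tx ty]; first by apply/asboolP/gsum0.
apply/asboolP/(gsumD ds); first exact/asboolP.
by apply: (gsumN ds); apply/asboolP.
Qed.

Lemma tailM a x : tail x -> tail (a * x).
Proof.
move=> [s [f [sf ->]]]; have ds := grR_ds B.
have : gsum (@grR B) setT a by rewrite ds_span.
move=> [t [h [th ->]]]; rewrite mulr_suml big_seq_cond.
apply: (gsum_sum ds) => i /andP[/th[_ hi] _]; rewrite mulr_sumr big_seq_cond.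
apply: (gsum_sum ds) => j /andP[/sf[nj fj] _].
have [i0|i0] := ltP i 0; first by rewrite (grR_neg i0 hi) mul0r; apply: gsum0.
by apply: (@gsum1 _ _ _ (i + j)); [rewrite /= ler_wpDl|apply: grR_M].
Qed.

Definition tailp : {pred B} := [pred x : B | `[< tail x >]].
HB.instance Definition _ := GRing.isZmodClosed.Build B tailp tail_zmod.

Definition tquot := Quotient.quot tailp.
HB.instance Definition _ := GRing.Zmodule.on tquot.

Definition tpi (a : B) : tquot := (\pi_(Quotient.quot tailp) a)%qT.

Lemma tpi_eq a b : tpi a = tpi b <-> tail (a - b).
Proof.
rewrite /tpi; split.
  by move=> /eqP; rewrite -Quotient.idealrBE => /asboolP.
by move=> /asboolP h; apply/eqP; rewrite -Quotient.idealrBE.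
Qed.

Lemma tpiB : {morph tpi : a b / a - b}.
Proof.
by move=> a b; rewrite /tpi !piE.
Qed.

Lemma tpi0 : tpi 0 = 0.
Proof. by rewrite -(subrr 0) tpiB subrr. Qed.

Lemma tpiD : {morph tpi : a b / a + b}.
Proof. by move=> a b; rewrite -{1}[b]opprK tpiB -[- b]sub0r tpiB tpi0 sub0r opprK. Qed.

Lemma tpi_sum (J : Type) (r : seq J) (F : J -> B) :
  tpi (\sum_(j <- r) F j) = \sum_(j <- r) tpi (F j).
Proof. exact: (big_morph tpi tpiD tpi0). Qed.

Lemma tpi_repr (q : tquot) : tpi (repr q) = q.
Proof. exact: reprK. Qed.

Definition tscale (a : B) (q : tquot) : tquot := tpi (a * repr q).

Lemma tscale_pi a b : tscale a (tpi b) = tpi (a * b).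
Proof.
apply/tpi_eq; rewrite -mulrBr; apply: tailM; apply/tpi_eq; exact: tpi_repr.
Qed.

Fact tscaleA a b q : tscale a (tscale b q) = tscale (a * b) q.
Proof.
by rewrite -[q]tpi_repr !tscale_pi mulrA.
Qed.
Fact tscale1 : left_id 1 tscale.
Proof.
by move=> q; rewrite -[q]tpi_repr tscale_pi mul1r.
Qed.
Fact tscaleDr : right_distributive tscale +%R.
Proof.
by move=> a p q; rewrite -[p]tpi_repr -[q]tpi_repr -tpiD !tscale_pi -tpiD mulrDr.
Qed.
Fact tscaleDl q : {morph tscale^~ q : a b / a + b}.
Proof.
by move=> a b; rewrite -[q]tpi_repr !tscale_pi -tpiD mulrDl.
Qed.
HB.instance Definition _ := GRing.Zmodule_isLmodule.Build B tquot
  tscaleA tscale1 tscaleDr tscaleDl.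

Definition tgr (j : int) : set tquot := [set q | exists2 a, grR j a & q = tpi a].

Lemma tgr_ds : direct_sum tgr.
Proof.
have ds := grR_ds B; split.
- by move=> i; exists 0; [apply: ds0|rewrite tpi0].
- move=> i _ _ [a Ba ->] [b Bb ->]; exists (a - b); last by rewrite tpiB.
  exact: dsB.
- apply/seteqP; split => // q _; rewrite -[q]tpi_repr.
  have : gsum (@grR B) setT (repr q) by rewrite ds_span.
  move=> [s [f [sf ->]]]; exists s, (tpi \o f); split; last exact: tpi_sum.
  by move=> i /sf[_ fi]; split => //; exists (f i).
move=> s q us gq q0 i si.
have /choice[f fP] : forall j, exists a, grR j a /\ q j = tpi a.
  by move=> j; have [a] := gq j; exists a.
have : tpi (\sum_(j <- s) f j) = tpi 0.
  by rewrite tpi_sum tpi0 -[RHS]q0; apply: eq_bigr => j _; case: (fP j).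
move=> /tpi_eq; rewrite subr0 => ts; have [Bi ->] := fP i.
have [ni|ni] := pselect (n%:Z <= i).
  by rewrite -tpi0; apply/tpi_eq; rewrite subr0; apply: gsum1 ni Bi.
by rewrite (gsum_sep ds us _ ts si ni) ?tpi0 // => j; case: (fP j).
Qed.

Lemma tgr_Z i j (a : B) (q : tquot) : grR i a -> tgr j q -> tgr (i + j) (a *: q).
Proof.
move=> Ba [b Bb ->]; exists (a * b); first exact: grR_M.
exact: tscale_pi.
Qed.

(* The graded left module B / B_{>=n}. *)
Definition trunc : grMod B := @GrMod B tquot tgr tgr_ds tgr_Z.

End Truncation.

(* The projection B / B_{>=n'} -> B / B_{>=n}, for n <= n'. *)
Definition trunc_proj (B : grRing) (n n' : nat) (q : trunc B n') : trunc B n :=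
  tpi n (repr (q : tquot B n')).

Lemma trunc_projE (B : grRing) (n n' : nat) (a : B) :
  (n <= n')%N -> @trunc_proj B n n' (tpi n' a) = tpi n a.
Proof.
move=> nn'; apply/tpi_eq.
have [s [f [sf ->]]] : tail n' (repr (tpi n' a) - a).
  by apply/tpi_eq; exact: tpi_repr.
exists s, f; split=> // i /sf[n'i fi]; split=> //=.
by apply: le_trans n'i; rewrite lez_nat.
Qed.

(* B / B_{>=1}, which is the trivial module k for a connected graded algebra. *)
Definition kmod (B : grRing) : grMod B := trunc B 1.

Section GradedHomology.
Variable B : grRing.

Definition homdeg (M N : grMod B) (e : int) (f : M -> N) : Prop :=
  forall j x, grM j x -> grM (j + e) (f x).

Definition trivial_mod (M : grMod B) : Prop := forall x : M, x = 0.

(* The submodule S of M is finitely generated. *)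
Definition fg_sub (M : lmodType B) (S : set M) : Prop :=
  exists (n : nat) (v : 'I_n -> M), (forall i, S (v i)) /\
    (forall x, S x -> exists c : 'I_n -> B, x = \sum_i c i *: v i).

Definition fin_gen (M : grMod B) : Prop := fg_sub [set: M].

Definition left_noetherian : Prop :=
  forall J : set B^o, J 0 ->
    (forall (a : B) (x y : B^o), J x -> J y -> J (a *: x + y)) -> fg_sub J.

(* Injective and projective objects of the category of graded modules and
   degree-0 homomorphisms. *)
Definition injective_mod (E : grMod B) : Prop :=
  forall (X Y : grMod B) (i : {linear X -> Y}) (f : {linear X -> E}),
    homdeg 0 i -> homdeg 0 f -> injective i ->
    exists g : {linear Y -> E}, homdeg 0 g /\ forall x, g (i x) = f x.

Definition projective_mod (P : grMod B) : Prop :=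
  forall (X Y : grMod B) (p : {linear X -> Y}) (f : {linear P -> Y}),
    homdeg 0 p -> homdeg 0 f -> (forall y, exists x, p x = y) ->
    exists g : {linear P -> X}, homdeg 0 g /\ forall x, p (g x) = f x.

Record injres (M : grMod B) := InjRes {
  ir :> nat -> grMod B;
  ir_inj : forall n, injective_mod (ir n);
  ird : forall n, {linear ir n -> ir n.+1};
  ird_deg : forall n, homdeg 0 (ird n);
  ira : {linear M -> ir 0};
  ira_deg : homdeg 0 ira;
  ira_inj : injective ira;
  ir_exact0 : forall x, ird 0 x = 0 <-> exists y, x = ira y;
  ir_exactS : forall n x, ird n.+1 x = 0 <-> exists y, x = ird n y }.

Record projres (M : grMod B) := ProjRes {
  pr :> nat -> grMod B;
  pr_proj : forall n, projective_mod (pr n);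
  prd : forall n, {linear pr n.+1 -> pr n};
  prd_deg : forall n, homdeg 0 (prd n);
  pra : {linear pr 0 -> M};
  pra_deg : homdeg 0 pra;
  pra_surj : forall y, exists x, pra x = y;
  pr_exact0 : forall x, pra x = 0 <-> exists y, x = prd 0 y;
  pr_exactS : forall n x, prd n x = 0 <-> exists y, x = prd n.+1 y }.

Definition length_le (C : nat -> grMod B) (n : nat) : Prop :=
  forall i, (n < i)%N -> trivial_mod (C i).

Definition injdim (M : grMod B) (d : nat) : Prop :=
  (exists I : injres M, length_le I d) /\
  (forall (I : injres M) n, length_le I n -> (d <= n)%N).

Definition projdim (M : grMod B) (d : nat) : Prop :=
  (exists P : projres M, length_le P d) /\
  (forall (P : projres M) n, length_le P n -> (d <= n)%N).

Definition finite_projdim (M : grMod B) : Prop := exists d, projdim M d.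

(* For an injective resolution I of M, Ext^i(N, M)_j is the subquotient
   [ext_Z i j] / [ext_B i j], the cohomology of the complex Hom(N, I). *)
Section Ext.
Variables (N M : grMod B) (I : injres M).

Definition ext_Z (i : nat) (j : int) : set {linear N -> I i} :=
  [set f | homdeg j f /\ forall x, ird I i (f x) = 0].

Definition ext_B (i : nat) (j : int) : set (N -> I i) :=
  match i with
  | 0 => [set f | forall x, f x = 0]
  | i'.+1 => [set f | exists g : {linear N -> I i'},
                homdeg j g /\ forall x, f x = ird I i' (g x)]
  end.

Definition ext_zero (i : nat) (j : int) : Prop :=
  forall f, ext_Z j f -> @ext_B i j f.

(* Ext^i(N, M)_j is isomorphic to k as a k-vector space, where k acts through
   the central homomorphism [iota]: phi induces the isomorphism. *)
Definition ext_line (k : fieldType) (iota : k -> B) (i : nat) (j : int) :=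
  exists phi : {linear N -> I i} -> k,
    [/\ forall (c : k) f g h, ext_Z j f -> ext_Z j g -> ext_Z j h ->
          (forall x, h x = iota c *: f x + g x) -> phi h = c * phi f + phi g,
        forall c : k, exists2 f, ext_Z j f & phi f = c
      & forall f, ext_Z j f -> (phi f = 0 <-> ext_B j f)].

(* Ext^i(N, M) is isomorphic to k(l), where k(l)_j = k_{j+l}: it is k in degree
   -l and zero in the other degrees. When N = k it has a further module
   structure, but on such a graded vector space there is only one, because
   B_{>=1} raises degrees. *)
Definition ext_shift (k : fieldType) (iota : k -> B) (i : nat) (l : int) :=
  forall j, if j + l == 0 then ext_line iota i j else ext_zero i j.

End Ext.

Section LocalCohomology.
Variables (M : grMod B) (I : injres M).

(* The j such that H^i_m(M)_j = colim_n Ext^i(B/B_{>=n}, M)_j is nonzero. An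
   element of the colimit is the class of a cocycle at some stage n, and it is
   zero iff its image at some stage n' >= n is a coboundary. *)
Definition lcoh_supp (i : nat) : set int :=
  [set j | exists (n : nat) (f : {linear trunc B n -> I i}), ext_Z j f /\
     forall n' : nat, (n <= n')%N -> ~ ext_B j (f \o @trunc_proj B n n')].

Definition cohen_macaulay (s : nat) : Prop :=
  (forall i, i <> s -> lcoh_supp i = set0) /\ lcoh_supp s !=set0.

End LocalCohomology.

(* For a right module N, elements of the tensor product N (x)_B P are written as
   formal sums of pure tensors, and [tens_eq] is equality in N (x)_B P: two
   formal sums are equal iff every balanced biadditive map identifies them. *)
Section Tensor.
Variables (N : grMod (grop B)) (P : grMod B).

Record balanced (V : zmodType) (b : N -> P -> V) : Prop := Balanced {
  bal_addl : forall x y p, b (x + y) p = b x p + b y p;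
  bal_addr : forall x p q, b x (p + q) = b x p + b x q;
  bal_mid : forall (a : B) x p, b ((a : grop B) *: x) p = b x (a *: p) }.

Definition tens_eq (s t : seq (N * P)) : Prop :=
  forall (V : zmodType) (b : N -> P -> V), balanced b ->
    \sum_(u <- s) b u.1 u.2 = \sum_(u <- t) b u.1 u.2.

(* The formal sums of homogeneous pure tensors of total degree j; they represent
   the elements of (N (x)_B P)_j. *)
Definition tens_deg (j : int) : set (seq (N * P)) :=
  [set s | forall u, u \in s -> exists p q : int,
     [/\ grM p u.1, grM q u.2 & p + q = j]].

End Tensor.

Definition tens_map (N : grMod (grop B)) (P Q : grMod B) (f : P -> Q)
    (s : seq (N * P)) : seq (N * Q) := [seq (u.1, f u.2) | u <- s].

(* For a projective resolution P of M, Tor_i(N, M)_j is the subquotient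
   [tor_Z i j] / [tor_B i j], the homology of the complex N (x)_B P. *)
Section Tor.
Variables (N : grMod (grop B)) (M : grMod B) (P : projres M).

Definition tor_Z (i : nat) (j : int) : set (seq (N * P i)) :=
  match i with
  | 0 => [set s | tens_deg j s]
  | i'.+1 => [set s | tens_deg j s /\ tens_eq (tens_map (prd P i') s) [::]]
  end.

Definition tor_B (i : nat) (j : int) : set (seq (N * P i)) :=
  [set s | exists2 t : seq (N * P i.+1),
     tens_deg j t & tens_eq s (tens_map (prd P i) t)].

(* The j such that Tor_i(N, M)_j is nonzero. *)
Definition tor_supp (i : nat) : set int :=
  [set j | exists2 s : seq (N * P i), tor_Z j s & ~ tor_B j s].

End Tor.

End GradedHomology.

Definition noetherian (k : fieldType) (A : cgAlg k) : Prop :=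
  left_noetherian (lring A) /\ left_noetherian (rring A).

Definition AS_gorenstein_side (k : fieldType) (B : grRing) (iota : k -> B)
    (d : nat) (l : int) : Prop :=
  injdim (regular B) d /\
  forall I : injres (regular B),
    (forall i j, i <> d -> ext_zero (kmod B) I i j) /\
    ext_shift (kmod B) I iota d l.

Definition AS_gorenstein (k : fieldType) (A : cgAlg k) (d : nat) (l : int) :=
  @AS_gorenstein_side k (lring A) (fun c => c%:A : A) d l /\
  @AS_gorenstein_side k (rring A) (fun c => c%:A : A) d l.

(* deg of a graded vector space with support S; the value is -oo if S is empty. *)
Definition gdeg (R : realType) (S : set int) : \bar R :=
  ereal_sup [set (j%:~R)%:E | j in S].

(* H^i_m(M) is zero for negative i, so i ranges over nat. *)
Definition CMreg (R : realType) (B : grRing) (M : grMod B) (I : injres M)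
    (xi : R) : \bar R :=
  ereal_sup [set (p.2%:~R + xi * p.1%:R)%:E
            | p in [set p : nat * int | lcoh_supp I p.1 p.2]].

(* Main.v *)
Require Import Defs.
From HB Require Import structures.
From mathcomp Require Import all_boot all_order all_algebra.
From mathcomp Require Import all_classical all_reals all_analysis.
From mathcomp Require Import lra.

Set Implicit Arguments.
Unset Strict Implicit.
Unset Printing Implicit Defensive.

Import Order.TTheory GRing.Theory Num.Theory.

Local Open Scope classical_set_scope.
Local Open Scope ring_scope.

(** Only the vanishing of graded pieces of Ext and Tor matters. Let F be the
    minimal free resolution of M. Since Ext^i(k, A) is concentrated in
    cohomological degree d and internal degree -l, a dimension shift along F
    shows that Ext^(d-i)(k, M) is nonzero in degree j if and only if F_i has a
    generator in degree j + l, i.e. Tor_i(k, M) is nonzero in degree j + l: the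
    maps induced on Ext^d(k, -) by the differential of F vanish by minimality,
    and the finite length of F kills Ext^a(k, -) of the syzygies for a > d.

    A/A_{>=n} is an iterated extension of modules k(-a) with a >= 0, so
    H^q_m(M)_j <> 0 forces Ext^q(k, M) to be nonzero in some degree >= j; this
    is the inequality <=. Conversely, if Tor_{i+1}(k, M) has no degree above the
    degree b of a generator of F_i, the class of this generator in
    Ext^(d-i)(k, M) survives in the colimit, so that H^(d-i)_m(M) is nonzero in
    degree b - l. As xi <= 1, replacing a generator of F_i by one of F_{i+1} of
    larger degree does not decrease b - xi i, and this can be repeated until the
    previous condition holds; this is the inequality >=. *)

(** * Homogeneous components *)

Section Components.
Variables (V : zmodType) (g : int -> set V).
Hypothesis gds : direct_sum g.

(** Finite support is expressed through a list [s] such that every duplicate-free list containing it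
    computes the sum; two decompositions can then be compared on a common list. *)
Definition decomposes (x : V) (h : int -> V) : Prop :=
  (forall i, g i (h i)) /\
  exists s : seq int, forall t, uniq t -> {subset s <= t} ->
    x = \sum_(i <- t) h i.

Lemma decomposes_exists x : exists h, decomposes x h.
Proof.
have : gsum g setT x by rewrite (ds_span gds).
move=> /(gsum_uniq gds)[s [f [us gf _ ->]]].
exists (fun i => if i \in s then f i else 0); split.
  by move=> i; case: ifP => // _; apply: ds0.
by exists s => t ut st; rewrite big_sub_uniq.
Qed.

Lemma decomposes_lin x y h h' :
  decomposes x h -> decomposes y h' -> decomposes (x - y) (fun i => h i - h' i).
Proof.
move=> [gh [s hs]] [gh' [s' hs']]; split; first by move=> i; apply: dsB.
exists (s ++ s') => t ut st; rewrite sumrB -hs -?hs' //.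
- by move=> i si; apply: st; rewrite mem_cat si orbT.
- by move=> i si; apply: st; rewrite mem_cat si.
Qed.

Lemma decomposes0 h : decomposes 0 h -> forall i, h i = 0.
Proof.
move=> [gh [s hs]] i; apply: (ds_free gds (undup_uniq (i :: s)) gh).
  rewrite -hs ?undup_uniq // => j js; by rewrite mem_undup inE js orbT.
by rewrite mem_undup inE eqxx.
Qed.

Lemma decomposes_uniq x h h' : decomposes x h -> decomposes x h' -> h = h'.
Proof.
move=> hx hx'; have := decomposes_lin hx hx'; rewrite subrr => /decomposes0 h0.
by apply/funext => i; apply/eqP; rewrite -subr_eq0 h0.
Qed.

End Components.

Definition cmp (V : zmodType) (g : int -> set V) (gds : direct_sum g)
    (j : int) (x : V) : V := projT1 (cid (decomposes_exists gds x)) j.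

Section ComponentTheory.
Variables (V : zmodType) (g : int -> set V).
Hypothesis gds : direct_sum g.

Lemma cmpP x : decomposes g x (cmp gds ^~ x).
Proof. by rewrite /cmp; case: cid. Qed.

Lemma cmp_uniq x h : decomposes g x h -> forall j, cmp gds j x = h j.
Proof. by move=> hx j; rewrite -(decomposes_uniq gds (cmpP x) hx). Qed.

Lemma cmp_in j x : g j (cmp gds j x).
Proof. by case: (cmpP x). Qed.

Lemma cmp_homog i j x : g i x -> cmp gds j x = if j == i then x else 0.
Proof.
move=> gx; apply: (@cmp_uniq _ (fun j => if j == i then x else 0)); split.
  by move=> k; case: eqP => [->//|_]; apply: ds0.
exists [:: i] => t ut it; have ti : i \in t by apply: it; rewrite inE.
by rewrite (bigD1_seq i ti ut) /= eqxx big1 ?addr0 // => k /negPf ->.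
Qed.

Lemma cmp_id j x : g j x -> cmp gds j x = x.
Proof. by move=> gx; rewrite (cmp_homog _ gx) eqxx. Qed.

Lemma cmpB j : {morph cmp gds j : x y / x - y}.
Proof.
by move=> x y; exact: (cmp_uniq (decomposes_lin gds (cmpP x) (cmpP y)) j).
Qed.

Lemma cmp0 j : cmp gds j 0 = 0.
Proof. by have := cmpB j 0 0; rewrite !subrr. Qed.

Lemma cmpN j : {morph cmp gds j : x / - x}.
Proof. by move=> x; rewrite -[- x]sub0r cmpB cmp0 sub0r. Qed.

Lemma cmpD j : {morph cmp gds j : x y / x + y}.
Proof. by move=> x y; rewrite -{1}[y]opprK cmpB cmpN opprK. Qed.

Lemma cmp_sum j (J : Type) (r : seq J) (P : pred J) (F : J -> V) :
  cmp gds j (\sum_(i <- r | P i) F i) = \sum_(i <- r | P i) cmp gds j (F i).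
Proof. exact: (big_morph (cmp gds j) (cmpD j) (cmp0 j)). Qed.

Lemma sum_cmp x : exists2 s : seq int, uniq s & x = \sum_(i <- s) cmp gds i x.
Proof.
have [_ [s hs]] := cmpP x; exists (undup s); first exact: undup_uniq.
by apply: hs; [exact: undup_uniq | move=> i; rewrite mem_undup].
Qed.

Lemma gsum_cmp (D : set int) x :
  gsum g D x <-> forall j, ~ D j -> cmp gds j x = 0.
Proof.
split=> [[s [f [sf ->]]] j nDj|x0].
  rewrite cmp_sum big_seq big1 // => i /sf[Di gi].
  by rewrite (cmp_homog _ gi); case: eqP => // ji; rewrite ji in nDj.
have [s us ->] := sum_cmp x; apply: (gsum_sum gds) => i _.
have [Di|nDi] := pselect (D i); first by apply: (gsum1 Di); apply: cmp_in.
by rewrite x0 //; apply: gsum0.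
Qed.

End ComponentTheory.

Section Graded.
Variable B : grRing.

Definition mcmp (M : grMod B) (j : int) (x : M) : M := cmp (grM_ds M) j x.
Definition rcmp (j : int) (a : B) : B := cmp (grR_ds B) j a.

Lemma mcmp_in (M : grMod B) j (x : M) : grM j (mcmp j x).
Proof. exact: cmp_in. Qed.

Lemma rcmp_in j (a : B) : grR j (rcmp j a).
Proof. exact: cmp_in. Qed.

Lemma mcmpZ (M : grMod B) i j (a : B) (x : M) : grM i x ->
  mcmp j (a *: x) = rcmp (j - i) a *: x.
Proof.
move=> gx; have [s _ ea] := sum_cmp (grR_ds B) a.
rewrite {1}ea scaler_suml /mcmp cmp_sum -/(rcmp _ _).
rewrite [in RHS]ea /rcmp cmp_sum scaler_suml; apply: eq_bigr => t _.
have gt : grM (t + i) (cmp (grR_ds B) t a *: x).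
  by apply: grM_Z => //; apply: cmp_in.
rewrite (cmp_homog _ _ gt) (cmp_homog _ _ (rcmp_in t a)) /rcmp.
have -> : (j == t + i) = (j - i == t) by rewrite subr_eq.
by case: eqP; rewrite ?scale0r.
Qed.

Lemma mcmp_hom (M N : grMod B) e (f : {linear M -> N}) j x :
  homdeg e f -> mcmp (j + e) (f x) = f (mcmp j x).
Proof.
move=> df; have [s _ ex] := sum_cmp (grM_ds M) x.
rewrite {1}ex linear_sum /mcmp cmp_sum.
rewrite [in RHS]ex cmp_sum linear_sum; apply: eq_bigr => t _.
have gt : grM (t + e) (f (cmp (grM_ds M) t x)) by apply: df; apply: cmp_in.
rewrite (cmp_homog _ _ gt) (cmp_homog _ _ (mcmp_in t x)).
have -> : (j + e == t + e) = (j == t) by rewrite (inj_eq (addIr _)).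
by case: eqP; rewrite ?linear0.
Qed.

End Graded.
Definition mklin (R : nzRingType) (U V : lmodType R) (f : U -> V)
    (H : linear f) : {linear U -> V} :=
  HB.pack f (GRing.isLinear.Build R U V *:%R f H).

(** * Graded submodules and lifting *)

Section Submodule.
Variable B : grRing.

Record gsubmod (M : grMod B) := GSubmod {
  gs_set :> M -> Prop;
  gs_0 : gs_set 0;
  gs_lin : forall (a : B) x y, gs_set x -> gs_set y -> gs_set (a *: x + y);
  gs_cmp : forall j x, gs_set x -> gs_set (mcmp j x) }.

Variables (M : grMod B) (S : gsubmod M).

Definition gs_pred : {pred M} := [pred x : M | `[< S x >]].

Lemma gs_submod_closed : submod_closed gs_pred.
Proof.
split=> [|a x y /asboolP Sx /asboolP Sy]; apply/asboolP; first exact: gs_0.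
exact: gs_lin.
Qed.
HB.instance Definition _ := GRing.isSubmodClosed.Build B M gs_pred
  gs_submod_closed.

Record gs_type := GSType { gs_val :> M; _ : gs_val \in gs_pred }.
HB.instance Definition _ := [isSub for gs_val].
HB.instance Definition _ := [Choice of gs_type by <:].
HB.instance Definition _ := [SubChoice_isSubLmodule of gs_type by <:].

Lemma gs_valP (x : gs_type) : S (gs_val x).
Proof. by apply/asboolP; case: x. Qed.

Definition gs_mk (x : M) (Sx : S x) : gs_type :=
  @GSType x (introT (asboolP (S x)) Sx).

Lemma gs_val_sum (s : seq int) (f : int -> gs_type) :
  gs_val (\sum_(i <- s) f i) = \sum_(i <- s) gs_val (f i).
Proof. by apply: (big_morph gs_val) => [x y|]. Qed.

Definition gs_gr (j : int) : set gs_type := [set x | grM j (gs_val x)].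

Lemma gs_ds : direct_sum gs_gr.
Proof.
have ds := grM_ds M; split.
- by move=> i; apply: (ds0 ds i).
- by move=> i x y gx gy; apply: (dsB ds gx gy).
- apply/seteqP; split=> // x _; have [s us ex] := sum_cmp (grM_ds M) (gs_val x).
  exists s, (fun i => gs_mk (gs_cmp i (gs_valP x))); split.
    by move=> i _; split=> //; apply: cmp_in.
  by apply: val_inj; rewrite [RHS]gs_val_sum.
move=> s f us gf sf i si; apply: val_inj; rewrite [RHS]raddf0.
apply: (ds_free ds us (f := fun i => gs_val (f i))) si => //.
by rewrite -gs_val_sum sf.
Qed.

Lemma gs_grZ i j (a : B) (x : gs_type) :
  grR i a -> gs_gr j x -> gs_gr (i + j) (a *: x).
Proof. by move=> ga gx; apply: grM_Z. Qed.

Definition gsub : grMod B := @GrMod B gs_type gs_gr gs_ds gs_grZ.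

Definition gs_incl : {linear gsub -> M} := (val : gs_type -> M).

End Submodule.

Section GradedMaps.
Variable B : grRing.

Lemma homdeg_comp (X Y Z : grMod B) e e' (f : X -> Y) (g : Y -> Z) :
  homdeg e f -> homdeg e' g -> homdeg (e + e') (g \o f).
Proof. by move=> df dg j x gx; rewrite addrA; apply: dg; apply: df. Qed.

Lemma homdegD (X Y : grMod B) e (f g : X -> Y) :
  homdeg e f -> homdeg e g -> homdeg e (f \+ g).
Proof.
by move=> df dg j x gx; apply: (dsD (grM_ds Y)); [apply: df|apply: dg].
Qed.

Lemma homdegB (X Y : grMod B) e (f g : X -> Y) :
  homdeg e f -> homdeg e g -> homdeg e (f \- g).
Proof.
by move=> df dg j x gx; apply: (dsB (grM_ds Y)); [apply: df|apply: dg].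
Qed.

Lemma homdeg_null (X Y : grMod B) e : homdeg e ((fun=> 0) : X -> Y).
Proof. by move=> j x _; apply: (ds0 (grM_ds Y)). Qed.

Definition setT_gsub (M : grMod B) : gsubmod M.
Proof. by exists setT. Defined.

Definition ker_gsub (M N : grMod B) e (f : {linear M -> N})
  (df : homdeg e f) : gsubmod M.
Proof.
exists (fun x => f x = 0).
- exact: linear0.
- by move=> a x y fx fy; rewrite linearP /= fx fy scaler0 addr0.
- by move=> j x fx; rewrite -(mcmp_hom _ _ df) fx /mcmp cmp0.
Defined.

Definition im_gsub (M N : grMod B) (f : {linear M -> N})
  (df : homdeg 0 f) : gsubmod N.
Proof.
exists (fun y => exists x, y = f x).
- by exists 0; rewrite linear0.
- by move=> a _ _ [x ->] [y ->]; exists (a *: x + y); rewrite linearP.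
- move=> j _ [x ->]; exists (mcmp j x).
  by rewrite -(mcmp_hom _ _ df) addr0.
Defined.

Section Shift.
Variables (M : grMod B) (e : int).

(** The grading of M(e). Shifting turns maps of degree [j] into maps of degree 0, the only ones that
    the definitions of projective and injective modules speak of. *)
Definition shift_gr (j : int) : set M := grM (j + e).

Lemma shift_ds : direct_sum shift_gr.
Proof.
have ds := grM_ds M; split.
- by move=> i; apply: (ds0 ds).
- by move=> i x y; apply: (dsB ds).
- apply/seteqP; split=> // x _; have [s us ex] := sum_cmp ds x.
  exists [seq i - e | i <- s], (fun i => cmp ds (i + e) x); split.
    by move=> i _; split=> //; apply: cmp_in.
  by rewrite big_map [LHS]ex; apply: eq_bigr => i _; rewrite subrK.
move=> s f us gf sf i si.
rewrite -[i](addrK e); apply: (ds_free ds (s := [seq i + e | i <- s])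
  (f := fun i => f (i - e))).
- by rewrite map_inj_uniq //; apply: addIr.
- by move=> k; have := gf (k - e); rewrite /shift_gr subrK.
- by rewrite big_map -[RHS]sf; apply: eq_bigr => k _; rewrite addrK.
- exact: map_f.
Qed.

Lemma shift_grZ i j (a : B) (x : M) :
  grR i a -> shift_gr j x -> shift_gr (i + j) (a *: x).
Proof. by move=> ga gx; rewrite /shift_gr -addrA; apply: grM_Z. Qed.

Definition gshift : grMod B := @GrMod B M shift_gr shift_ds shift_grZ.

End Shift.

Lemma corestr_lin (X Y : grMod B) (S : gsubmod Y) (f : {linear X -> Y})
  (fS : forall x, S (f x)) : linear (fun x => gs_mk (fS x) : gsub S).
Proof. by move=> a x y; apply: val_inj; apply: linearP. Qed.

Definition corestr (X Y : grMod B) (S : gsubmod Y) (f : {linear X -> Y})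
  (fS : forall x, S (f x)) : {linear X -> gsub S} := mklin (corestr_lin fS).

(** Corestricting [u] to its image makes it surjective, and shifting [X] and the image by [j] makes
    [f] a map of degree 0; projectivity then applies. *)
Lemma proj_lift (P X Y : grMod B) (u : {linear X -> Y}) (f : {linear P -> Y})
    j :
  projective_mod P -> homdeg 0 u -> homdeg j f ->
  (forall p, exists x, f p = u x) ->
  exists h : {linear P -> X}, homdeg j h /\ forall p, u (h p) = f p.
Proof.
move=> hP du df fu; pose S := im_gsub du.
have uS x : S (u x) by exists x.
have [||y|h [dh hE]] := hP (gshift X j) (gshift (gsub S) j)
  (corestr uS) (corestr (fu : forall p, S (f p))).
- by move=> i x gx; have := du _ _ gx; rewrite !addr0.
- by move=> i x gx; have := df _ _ gx; rewrite addr0.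
- have [x ex] := gs_valP y; exists x; apply: val_inj; exact: esym.
exists h; split; first by move=> i x gx; have := dh _ _ gx; rewrite addr0.
by move=> p; have := congr1 (@gs_val _ _ _) (hE p).
Qed.

(** The map [f] factors through the image of [u]; injectivity extends the induced map from this
    graded submodule to [Y], after a shift by [- j] that brings it to degree 0. *)
Lemma inj_ext (E X Y : grMod B) (u : {linear X -> Y}) (f : {linear X -> E}) j :
  injective_mod E -> homdeg 0 u -> homdeg j f ->
  (forall x, u x = 0 -> f x = 0) ->
  exists g : {linear Y -> E}, homdeg j g /\ forall x, g (u x) = f x.
Proof.
move=> hE du df uf; pose S := im_gsub du.
have ufE x y : u x = u y -> f x = f y.
  move=> e; apply/eqP; rewrite -subr_eq0 -linearB /=; apply/eqP/uf.
  by rewrite linearB /= e subrr.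
have pre (w : gsub S) : exists x, gs_val w = u x by have := gs_valP w.
pose fb (w : gsub S) : E := f (projT1 (cid (pre w))).
have fbE w x : gs_val w = u x -> fb w = f x.
  by move=> e; apply: ufE; rewrite -e; case: cid.
have fbl : linear fb.
  move=> a w w'; have [x ex] := pre w; have [x' ex'] := pre w'.
  rewrite (fbE w x ex) (fbE w' x' ex') (fbE _ (a *: x + x')) ?linearP //.
  by rewrite -ex -ex'.
have [|||g [dg gE]] := hE (gshift (gsub S) (- j)) (gshift Y (- j))
  (gs_incl S) (mklin fbl).
- by move=> i w gw; rewrite addr0.
- move=> i w gw; have [x ex] := pre w.
  (* The component of suitable degree of a preimage of a homogeneous element is again a preimage. *)
  have ex' : gs_val w = u (mcmp (i - j) x).
    rewrite -(mcmp_hom _ _ du) -ex /mcmp addr0 cmp_id //.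
  have := df _ _ (mcmp_in (i - j) x); rewrite subrK addr0.
  by rewrite -(fbE _ _ ex').
- exact: val_inj.
exists g; split.
  move=> i x gx; have := dg (i + j) x; rewrite addr0; apply.
  by rewrite /= /shift_gr addrK.
move=> x; have uS : S (u x) by exists x.
by rewrite -[u x]/(gs_incl S (gs_mk uS)) gE; apply: fbE.
Qed.

End GradedMaps.

(** * Free modules and minimal generators *)

Section Free.
Variables (B : grRing) (n : nat) (b : 'I_n -> int).

Definition fr_type := {ffun 'I_n -> B^o}.

(** The [i]-th basis element has degree [b i], so this is the direct sum of the modules B(-b i). *)
Definition fr_gr (j : int) : set fr_type :=
  [set x | forall i, grR (j - b i) (x i : B)].

Lemma fr_ds : direct_sum fr_gr.
Proof.
have ds := grR_ds B; split.
- by move=> j i; rewrite ffunE; apply: (ds0 ds).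
- by move=> j x y gx gy i; rewrite !ffunE; apply: (dsB ds).
- apply/seteqP; split=> // x _.
  have /choice[s hs] : forall i, exists s : seq int, forall t, uniq t ->
      {subset s <= t} -> x i = \sum_(j <- t) rcmp j (x i : B).
    by move=> i; have [_ [s hs]] := cmpP (grR_ds B) (x i : B); exists s.
  (* A list of degrees that serves all coordinates at once. *)
  pose S := undup (flatten [seq [seq j + b i | j <- s i] | i <- enum 'I_n]).
  exists S, (fun j => [ffun i => rcmp (j - b i) (x i : B)]); split.
    by move=> j _; split=> // i; rewrite ffunE; apply: rcmp_in.
  apply/ffunP => i; rewrite sum_ffunE.
  rewrite {1}(hs i [seq j - b i | j <- S]); last 2 first.
  - by rewrite map_inj_uniq ?undup_uniq //; apply: addIr.
  - move=> j js; rewrite -[j](addrK (b i)); apply: map_f.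
    rewrite mem_undup; apply/flatten_mapP; exists i; first by rewrite mem_enum.
    exact: (map_f (fun j => j + b i)).
  by rewrite big_map; apply: eq_bigr => j _; rewrite ffunE.
move=> s f us gf sf i si; apply/ffunP => k; rewrite ffunE.
rewrite -[i](subrK (b k)).
apply: (ds_free ds (s := [seq i - b k | i <- s]) (f := fun j => f (j + b k) k)).
- by rewrite map_inj_uniq //; apply: addIr.
- by move=> j; have := gf (j + b k) k; rewrite addrK.
- rewrite big_map; have /ffunP/(_ k) := sf; rewrite sum_ffunE ffunE => e0.
  by rewrite -[RHS]e0; apply: eq_bigr => j _; rewrite subrK.
- exact: (map_f (fun i => i - b k)).
Qed.

Lemma fr_grZ i j (a : B) (x : fr_type) :
  grR i a -> fr_gr j x -> fr_gr (i + j) (a *: x).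
Proof.
by move=> ga gx k; rewrite ffunE -addrA; apply: grR_M.
Qed.

Definition free : grMod B := @GrMod B fr_type fr_gr fr_ds fr_grZ.

Definition fr_e (i : 'I_n) : free := [ffun j => (j == i)%:R : B^o].

Lemma fr_e_deg i : grM (b i) (fr_e i).
Proof.
move=> j; rewrite ffunE; case: eqP => [->|_]; last exact: (ds0 (grR_ds B)).
by rewrite subrr; apply: grR_1.
Qed.

Lemma fr_sum (x : free) : x = \sum_i (x i : B) *: fr_e i.
Proof.
apply/ffunP => j; rewrite sum_ffunE (bigD1 j) //= big1 ?addr0.
  by rewrite !ffunE eqxx [RHS]mulr1.
by move=> i ij; rewrite !ffunE eq_sym (negPf ij) [LHS]mulr0.
Qed.

Section Map.
Variables (M : grMod B) (u : 'I_n -> M).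

Lemma frmap_lin : linear (fun x : free => \sum_i (x i : B) *: u i).
Proof.
move=> a x y; rewrite scaler_sumr -big_split; apply: eq_bigr => i _ /=.
by rewrite !ffunE scalerDl scalerA.
Qed.

Definition frmap : {linear free -> M} := mklin frmap_lin.

Lemma frmapE x : frmap x = \sum_i (x i : B) *: u i.
Proof. by []. Qed.

Lemma frmap_e i : frmap (fr_e i) = u i.
Proof.
rewrite frmapE (bigD1 i) //= big1 ?addr0; first by rewrite ffunE eqxx scale1r.
by move=> j ji; rewrite ffunE (negPf ji) scale0r.
Qed.

Lemma frmap_deg e : (forall i, grM (b i + e) (u i)) -> homdeg e frmap.
Proof.
move=> gu j x gx; rewrite frmapE; elim/big_rec: _ => [|i y _ gy].
  exact: (ds0 (grM_ds M)).
apply: (dsD (grM_ds M)) => //; rewrite -[j](subrK (b i)) -addrA.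
by apply: grM_Z => //; apply: gx.
Qed.

End Map.

Lemma free_ext (M : grMod B) (f g : {linear free -> M}) :
  (forall i, f (fr_e i) = g (fr_e i)) -> forall x, f x = g x.
Proof.
move=> fg x; rewrite [x]fr_sum !linear_sum; apply: eq_bigr => i _.
by rewrite !linearZ /= fg.
Qed.

Lemma free_projective : projective_mod free.
Proof.
move=> X Y p f dp df ps.
have /choice[v hv] : forall i, exists x : X, grM (b i) x /\ p x = f (fr_e i).
  move=> i; have [x ex] := ps (f (fr_e i)); exists (mcmp (b i) x).
  split; first exact: mcmp_in.
  rewrite -(mcmp_hom _ _ dp) ex addr0 /mcmp cmp_id //.
  by have := df _ _ (fr_e_deg i); rewrite addr0.
exists (frmap v); split.
  by apply: frmap_deg => i; rewrite addr0; case: (hv i).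
move=> x; apply: (@free_ext Y (p \o frmap v) f) => i.
by rewrite -[LHS]/(p (frmap v (fr_e i))) frmap_e; case: (hv i).
Qed.

End Free.

Section Generators.
Variable B : grRing.

(** Induction on the number of generators of the ambient module. The possible coefficients of
    [v ord0] in elements of [S] form a left ideal [J]; elements of [S] realising generators of [J],
    together with generators of the part of [S] spanned by the other [v i], generate [S].
    Coefficients are not unique, so [T] is a relation. *)
Lemma noetherian_fg_sub (M : lmodType B) n (v : 'I_n -> M) (S : set M) :
  left_noetherian B -> S 0 ->
  (forall (a : B) x y, S x -> S y -> S (a *: x + y)) ->
  (forall x, S x -> exists c : 'I_n -> B, x = \sum_i c i *: v i) -> fg_sub S.
Proof.
move=> hB; elim: n v S => [|n IH] v S S0 SL Sv.
  exists 0%N, (fun=> 0); split=> [[]//|x /Sv[c ->]].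
  by exists (fun=> 0); rewrite !big_ord0.
pose T (a : B) (x : M) := exists c : 'I_n -> B,
  x = a *: v ord0 + \sum_i c i *: v (lift ord0 i).
have TL a b x c y : T b x -> T c y -> T (a * b + c) (a *: x + y).
  move=> [e ->] [e' ->]; exists (fun i => a * e i + e' i).
  rewrite scalerDr scalerDl scalerA addrACA; congr (_ + _).
  rewrite scaler_sumr -big_split; apply: eq_bigr => i _ /=.
  by rewrite scalerDl scalerA.
have T0 : T 0 0.
  by exists (fun=> 0); rewrite scale0r add0r big1 // => i _; rewrite scale0r.
pose J : set B^o := [set a | exists2 x, S x & T a x].
have [m [w [Jw gw]]] : fg_sub J.
  apply: hB; first by exists 0.
  move=> a b c [x Sx Tx] [y Sy Ty]; exists (a *: x + y); first exact: SL.
  exact: TL.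
have /choice[z zP] : forall i, exists x, S x /\ T (w i) x.
  by move=> i; have [x] := Jw i; exists x.
pose S' : set M := [set x | S x /\ T 0 x].
have [|||p [y [Sy gy]]] := IH (fun i => v (lift ord0 i)) S'.
- by split.
- move=> a x x' [Sx Tx] [Sx' Tx']; split; first exact: SL.
  by have := TL a _ _ _ _ Tx Tx'; rewrite mulr0 addr0.
- by move=> x [_ [c ->]]; exists c; rewrite scale0r add0r.
exists (m + p)%N,
  (fun i => match fintype.split i with inl i => z i | inr i => y i end).
split.
  by move=> i; case: (fintype.split i) => k; [case: (zP k)|case: (Sy k)].
move=> x Sx; have [c ec] := Sv x Sx.
have [|e ee] := gw (c ord0).
  by exists x => //; exists (fun i => c (lift ord0 i)); rewrite ec big_ord_recl.
have T1 : T (c ord0) x.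
  by exists (fun i => c (lift ord0 i)); rewrite ec big_ord_recl.
have [Sz Tz] :
    S (\sum_i e i *: z i) /\ T (\sum_i e i * w i) (\sum_i e i *: z i).
  apply: (big_rec2 (fun X a => S X /\ T a X)) => [//|i a X _ [SX TX]].
  by have [Szi Tzi] := zP i; split; [apply: SL|apply: TL].
have [|f ef] := gy (x - \sum_i e i *: z i).
  split; first by rewrite addrC -scaleN1r; apply: SL.
  rewrite addrC -scaleN1r; have := TL (-1) _ _ _ _ Tz T1.
  by rewrite ee mulN1r addNr.
exists (fun i => match fintype.split i with inl i => e i | inr i => f i end).
rewrite big_split_ord /= -[LHS](subrK (\sum_i e i *: z i)) ef addrC.
congr (_ + _); apply: eq_bigr => i _.
  by have /= -> := @fintype.unsplitK m p (inr i).
by have /= -> := @fintype.unsplitK m p (inl i).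
Qed.

Definition hom_gens (M : grMod B) (S : set M) n (b : 'I_n -> int)
    (u : 'I_n -> M) : Prop :=
  [/\ forall i, S (u i), forall i, grM (b i) (u i) &
      forall x, S x -> exists c : 'I_n -> B, x = \sum_i c i *: u i].

(** The homogeneous components of finitely many generators still generate, and they stay in [S]
    because [S] is graded. *)
Lemma fg_hom_gens (M : grMod B) (S : gsubmod M) : fg_sub S ->
  exists n (b : 'I_n -> int) (u : 'I_n -> M), hom_gens S b u.
Proof.
move=> [n [v [Sv gv]]].
have /choice[s hs] :
    forall i, exists s : seq int, v i = \sum_(j <- s) mcmp j (v i).
  by move=> i; have [s _ e] := sum_cmp (grM_ds M) (v i); exists s.
pose L := flatten [seq [seq (j, mcmp j (v i)) | j <- s i] | i <- enum 'I_n].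
pose t := in_tuple L.
exists (size L), (fun i => (tnth t i).1), (fun i => (tnth t i).2).
have inL i : exists k j, tnth t i = (j, mcmp j (v k)).
  by have /flatten_mapP[k _ /mapP[j _ ->]] := mem_tnth i t; exists k, j.
split.
- by move=> i; have [k [j ->]] := inL i; apply: gs_cmp; apply: Sv.
- by move=> i; have [k [j ->]] := inL i; apply: mcmp_in.
pose T (x : M) := exists c : 'I_(size L) -> B, x = \sum_i c i *: (tnth t i).2.
have TL a x y : T x -> T y -> T (a *: x + y).
  move=> [c ->] [e ->]; exists (fun i => a * c i + e i).
  rewrite scaler_sumr -big_split; apply: eq_bigr => i _ /=.
  by rewrite scalerDl scalerA.
have T0 : T 0 by exists (fun=> 0); rewrite big1 // => i _; rewrite scale0r.
have T1 p : p \in L -> T p.2.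
  move=> pL; have /tnthP[i ->] : p \in t by [].
  exists (fun k => (k == i)%:R); rewrite (bigD1 i) //= eqxx scale1r.
  by rewrite big1 ?addr0 // => k /negPf->; rewrite scale0r.
move=> x /gv[c ->]; suff : T (\sum_i c i *: v i) by [].
apply: (big_rec T) => // i y _; apply: (TL); rewrite hs big_seq.
apply: (big_rec T) => // j z js Tz; rewrite -[mcmp _ _]scale1r; apply: TL => //.
apply: (T1 (j, mcmp j (v i))); apply/flatten_mapP.
exists i; first by rewrite mem_enum.
exact: (map_f (fun j => (j, mcmp j (v i)))).
Qed.

(** For a connected graded algebra this holds because the degree 0 part is the field k. *)
Definition deg0_division : Prop :=
  forall c : B, grR 0 c -> c != 0 -> exists c' : B, c' * c = 1.

(* A generating family of minimal size satisfies no relation with a unit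
   coefficient, since such a relation would express one of the generators in
   terms of the others. *)
Lemma minimal_hom_gens (M : grMod B) (S : gsubmod M) :
  deg0_division -> fg_sub S ->
  exists n (b : 'I_n -> int) (u : 'I_n -> M), hom_gens S b u /\
    forall c : 'I_n -> B, \sum_i c i *: u i = 0 -> forall i, rcmp 0 (c i) = 0.
Proof.
move=> hB /fg_hom_gens[n0 hn0].
pose Q n := exists (b : 'I_n -> int) (u : 'I_n -> M), hom_gens S b u.
have exQ : exists n, `[< Q n >] by exists n0; apply/asboolP.
case: (ex_minnP exQ) => n /asboolP[b [u hu]] minn; exists n, b, u; split=> //.
move=> c c0 i0; apply: contrapT => /eqP ci0.
case: n => [|n] in b u hu minn c c0 i0 ci0 *; first by have := ltn_ord i0.
suff : Q n by move=> /asboolP/minn; rewrite ltnn.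
have [Su gu su] := hu.
have [c' c'1] := hB _ (rcmp_in 0 (c i0)) ci0.
exists (fun i => b (lift i0 i)), (fun i => u (lift i0 i)); split=> //.
have rel : u i0 = \sum_i (- (c' * rcmp (b i0 - b (lift i0 i)) (c (lift i0 i))))
    *: u (lift i0 i).
  have := congr1 (fun x => c' *: mcmp (b i0) x) c0.
  rewrite /= [mcmp _ 0]cmp0 scaler0 /mcmp cmp_sum (bigD1_ord i0) //=.
  rewrite -/(mcmp _ _).
  rewrite (mcmpZ _ _ (gu i0)) subrr scalerDr scalerA c'1 scale1r => /eqP.
  rewrite addr_eq0 => /eqP->; rewrite scaler_sumr -sumrN; apply: eq_bigr => i _.
  by rewrite -/(mcmp _ _) (mcmpZ _ _ (gu _)) scalerA scaleNr.
move=> x /su[e ->]; rewrite (bigD1_ord i0) //= {1}rel scaler_sumr -big_split /=.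
exists (fun i => e i0 * - (c' * rcmp (b i0 - b (lift i0 i)) (c (lift i0 i))) +
   e (lift i0 i)).
by apply: eq_bigr => i _; rewrite scalerA scalerDl.
Qed.

Lemma hom_gens_coef (M : grMod B) (S : set M) n (b : 'I_n -> int) u :
  hom_gens S b u -> forall j x, S x -> grM j x ->
  exists c : 'I_n -> B,
    (forall i, grR (j - b i) (c i)) /\ x = \sum_i c i *: u i.
Proof.
move=> [Su gu su] j x Sx gx; have [c ec] := su x Sx.
exists (fun i => rcmp (j - b i) (c i)); split.
  by move=> i; apply: rcmp_in.
rewrite -[LHS](cmp_id (grM_ds M) gx) ec cmp_sum; apply: eq_bigr => i _.
by rewrite -/(mcmp _ _) (mcmpZ _ _ (gu i)).
Qed.

End Generators.

(** * Minimal resolutions *)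

Section MinimalResolution.
Variable B : grRing.
Hypotheses (hB : deg0_division B) (hN : left_noetherian B).

(* Minimality: the kernel lies in [m F], where [m] is the ideal of elements of
   B without component of degree 0. *)
Record mincover (M : grMod B) := MinCover {
  mc_n : nat;
  mc_b : 'I_mc_n -> int;
  mc_f : {linear free B mc_b -> M};
  mc_deg : homdeg 0 mc_f;
  mc_min : forall x, mc_f x = 0 -> forall i, rcmp 0 (x i : B) = 0 }.

Lemma mincover_exists (M : grMod B) (S : gsubmod M) : fg_sub S ->
  exists c : mincover M, forall x, S x <-> exists y, x = mc_f c y.
Proof.
move=> /(minimal_hom_gens hB)[n [b [u [[Su gu su] minu]]]].
have fmin (x : free B b) : frmap b u x = 0 -> forall i, rcmp 0 (x i : B) = 0.
  exact: (minu (fun i => x i)).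
have du : homdeg 0 (frmap b u) by apply: frmap_deg => i; rewrite addr0.
exists (MinCover du fmin) => x; split=> [/su[c ->]|[y ->]] /=.
  exists ([ffun i => c i : B^o] : free B b).
  by rewrite [RHS](@frmapE _ _ b); apply: eq_bigr => i _; rewrite ffunE.
change (S (\sum_i (y i : B) *: u i)); apply: (big_rec S) => [|i z _ Sz].
  exact: gs_0.
exact: gs_lin.
Qed.

Lemma ker_fg (M : grMod B) n (b : 'I_n -> int) (f : {linear free B b -> M})
  (df : homdeg 0 f) : fg_sub (ker_gsub df).
Proof.
apply: (@noetherian_fg_sub _ _ _ (@fr_e B n b)) => //.
- exact: gs_0.
- by move=> a x y; apply: (@gs_lin _ _ (ker_gsub df)).
- by move=> x _; exists (fun i => x i); apply: fr_sum.
Qed.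

Record minres (M : grMod B) := MinRes {
  mr_n : nat -> nat;
  mr_b : forall i, 'I_(mr_n i) -> int;
  mr_d : forall i, {linear free B (@mr_b i.+1) -> free B (@mr_b i)};
  mr_ddeg : forall i, homdeg 0 (mr_d i);
  mr_a : {linear free B (@mr_b 0) -> M};
  mr_adeg : homdeg 0 mr_a;
  mr_surj : forall y, exists x, mr_a x = y;
  mr_exact0 : forall x, mr_a x = 0 <-> exists y, x = mr_d 0 y;
  mr_exactS : forall i x, mr_d i x = 0 <-> exists y, x = mr_d i.+1 y;
  mr_min0 : forall x, mr_a x = 0 -> forall k, rcmp 0 (x k : B) = 0;
  mr_minS : forall i x, mr_d i x = 0 -> forall k, rcmp 0 (x k : B) = 0 }.

Definition minres_projres (M : grMod B) (F : minres M) : projres M :=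
  @ProjRes B M (fun i => free B (@mr_b _ F i))
    (fun i => @free_projective B _ _) (mr_d F) (@mr_ddeg _ F) (mr_a F)
    (@mr_adeg _ F) (@mr_surj _ F) (@mr_exact0 _ F) (@mr_exactS _ F).

(** A cover need not be surjective: each stage covers a submodule, so a cover of the kernel is
    directly a differential into the previous free module. *)
Let stage := {M : grMod B & mincover M}.

Let next (s : stage) : stage :=
  existT _ (free B (@mc_b _ (projT2 s)))
    (projT1 (cid (mincover_exists (ker_fg (@mc_deg _ (projT2 s)))))).

Let nextP (s : stage) x :
  mc_f (projT2 s) x = 0 <-> exists y, x = mc_f (projT2 (next s)) y.
Proof. by rewrite /next /=; case: cid => c /= hc; apply: (hc x). Qed.

Lemma minres_exists (M : grMod B) : fin_gen M -> inhabited (minres M).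
Proof.
move=> hM; have [|c hc] := @mincover_exists M (setT_gsub M) => //.
pose st := fix st (i : nat) : stage :=
  if i is j.+1 then next (st j) else existT _ M c.
split; apply: (@MinRes M (fun i => mc_n (projT2 (st i)))
  (fun i => @mc_b _ (projT2 (st i))) (fun i => mc_f (projT2 (st i.+1)))
  (fun i => @mc_deg _ (projT2 (st i.+1))) (mc_f c) (@mc_deg _ c)).
- by move=> y; have /(_ I)[x ->] := (hc y).1; exists x.
- move=> x; exact (@nextP (st 0%N) x).
- move=> i x; exact (@nextP (st i.+1) x).
- exact: mc_min.
- by move=> i x hx k; apply: (@mc_min _ (projT2 (st i.+1)) x hx k).
Qed.

End MinimalResolution.

(** * Cohomology of Hom(Q, -) *)

Section HomCohomology.
Variables (B : grRing) (N : grMod B) (Q : projres N) (j : int).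

Lemma prd_prd a x : prd Q a (prd Q a.+1 x) = 0.
Proof. by apply/(pr_exactS (p := Q)); exists x. Qed.

(* Cocycles and coboundaries of degree j of the complex Hom(Q, S), for a
   submodule S of X. *)
Definition hcoc (X : grMod B) (S : set X) a (f : {linear Q a -> X}) : Prop :=
  [/\ homdeg j f, forall x, S (f x) & forall x, f (prd Q a x) = 0].

Definition hcob (X : grMod B) (S : set X) a : (Q a -> X) -> Prop :=
  match a with
  | 0 => fun f => forall x, f x = 0
  | a'.+1 => fun f => exists g : {linear Q a' -> X},
      [/\ homdeg j g, forall x, S (g x) & forall x, f x = g (prd Q a' x)]
  end.

(* H^a(Hom(Q, S)) = 0 in degree j. *)
Definition hvan (X : grMod B) (S : set X) a : Prop :=
  forall f : {linear Q a -> X}, hcoc S f -> hcob S f.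

(* The map H^a(Hom(Q, S)) -> H^a(Hom(Q, X)) is zero in degree j. *)
Definition hzero (X : grMod B) (S : set X) a : Prop :=
  forall f : {linear Q a -> X}, hcoc S f -> hcob setT f.

Lemma hcob_sub (X : grMod B) (S T : set X) a (f : Q a -> X) :
  S `<=` T -> hcob S f -> hcob T f.
Proof.
case: a f => // a f ST [g [dg Sg fg]]; exists g; split=> // x; exact: ST.
Qed.

Lemma hcob_ext (X : grMod B) (S : set X) a (f g : Q a -> X) :
  (forall x, f x = g x) -> hcob S f -> hcob S g.
Proof. by move=> /funext ->. Qed.

Lemma hcobD (X : grMod B) a (f g : Q a -> X) :
  hcob setT f -> hcob setT g -> hcob setT (f \+ g).
Proof.
case: a f g => [|a] f g /=; first by move=> f0 g0 x; rewrite /= f0 g0 addr0.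
move=> [h [dh _ fh]] [k [dk _ gk]]; exists (h \+ k); split=> //.
  exact: homdegD.
by move=> x /=; rewrite fh gk.
Qed.

Lemma hcob0 (X : grMod B) (S : set X) a (f : Q a -> X) :
  S 0 -> (forall x, f x = 0) -> hcob S f.
Proof.
move=> S0; case: a f => // a f f0; exists \0; split=> // x.
by move=> gx; apply: homdeg_null.
Qed.

Lemma hvan_hzero (X : grMod B) (S : set X) a : hvan S a -> hzero S a.
Proof. by move=> h f /h; apply: hcob_sub. Qed.

Lemma hvanT_hzero (X : grMod B) (S : set X) a : hvan (@setT X) a -> hzero S a.
Proof. by move=> h f [df _ cf]; apply: h. Qed.

Lemma hzero_hvan0 (X : grMod B) (S : set X) : hzero S 0 -> hvan S 0.
Proof. by []. Qed.

Lemma hvan0 (X : grMod B) (S : set X) a : S 0 -> (forall x, S x -> x = 0) ->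
  hvan S a.
Proof. by move=> S0 Sx f [df Sf cf]; apply: hcob0 => // x; apply: Sx. Qed.

End HomCohomology.

Lemma hcob_comp (B : grRing) (N : grMod B) (Q : projres N) j e
    (X Y : grMod B) (S : set Y) (u : {linear X -> Y}) a (f : Q a -> X) :
  homdeg e u -> (forall x, S (u x)) ->
  hcob j setT f -> hcob (j + e) S (u \o f).
Proof.
move=> du Su; case: a f => [|a] f /=; first by move=> f0 x; rewrite f0 linear0.
move=> [g [dg _ fg]]; exists (u \o g); split=> //= [|x]; last by rewrite fg.
exact: homdeg_comp.
Qed.

(** * The long exact cohomology sequence of 0 -> K -> X -> S -> 0 *)

Section LongExactSequence.
Variables (B : grRing) (N : grMod B) (Q : projres N) (j : int).
Variables (X Y : grMod B) (u : {linear X -> Y}) (K : set X) (S : set Y).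
Hypotheses (du : homdeg 0 u) (uK : forall x, u x = 0 <-> K x)
  (uS : forall y, S y <-> exists x, y = u x).

Lemma lift_coc a (f : {linear Q a -> Y}) : homdeg j f -> (forall x, S (f x)) ->
  exists2 h : {linear Q a -> X}, homdeg j h & forall x, u (h x) = f x.
Proof.
move=> df Sf; have [|h [dh hE]] := proj_lift (@pr_proj _ _ Q a) du df.
  by move=> p; apply/uS.
by exists h.
Qed.

Let Kcoc a (h : {linear Q a -> X}) : homdeg j h ->
  (forall x, u (h (prd Q a x)) = 0) -> hcoc j K (h \o prd Q a).
Proof.
move=> dh uh; split=> [|x|x] /=.
- by rewrite -[j]add0r; apply: homdeg_comp => //; apply: prd_deg.
- exact/uK.
- by rewrite prd_prd linear0.
Qed.

(** The connecting map sends the class of [f] to that of [h \o prd Q a], for a lift [h] of [f]. This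
    [K]-valued cocycle is a coboundary, and subtracting a [K]-valued primitive makes [h] a
    cocycle. *)
Lemma hvan_lift a : hvan Q j K a.+1 ->
  forall f : {linear Q a -> Y}, hcoc j S f ->
  exists2 h : {linear Q a -> X}, hcoc j setT h & forall x, f x = u (h x).
Proof.
move=> hK f [df Sf cf]; have [h dh hE] := lift_coc df Sf.
have [|g [dg Kg gE]] := hK (h \o prd Q a).
  by apply: Kcoc => // x; rewrite hE.
exists (h \- g); first split=> //= [|x].
- exact: homdegB.
- by rewrite -gE subrr.
by move=> x /=; rewrite linearB /= hE (uK (g x)).2 ?subr0.
Qed.

Lemma hvan_quot a : hvan Q j (@setT X) a -> hvan Q j K a.+1 -> hvan Q j S a.
Proof.
move=> hX hK f /(hvan_lift hK)[h /hX hh fE].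
apply: (@hcob_ext _ _ _ j _ _ _ (u \o h)) => [x|]; first by rewrite fE.
by rewrite -[j]addr0; apply: (hcob_comp du) => // x; apply/uS; exists x.
Qed.

(** Exactness at H^(a+1)(K): if [f] bounds [g] in [X], then [u \o g] is a cocycle in [S], hence a
    coboundary; lifting its primitive to [X] corrects [g] to a cochain with values in [K]. *)
Lemma hvan_ker a : hvan Q j S a -> hzero Q j K a.+1 -> hvan Q j K a.+1.
Proof.
move=> hS hK f fcoc; have [g [dg _ gE]] := hK f fcoc; case: fcoc => df Kf cf.
have ucoc : hcoc j S (u \o g).
  split=> [|x|x] /=.
  - by rewrite -[j]addr0; apply: homdeg_comp.
  - by apply/uS; exists (g x).
  - by rewrite -gE; apply/uK.
have := hS _ ucoc.
case: a hS hK f df Kf cf g dg gE {ucoc} => [|a] hS hK f df Kf cf g dg gE /=.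
  by move=> ug; exists g; split=> // x; apply/uK; rewrite ug.
move=> [k [dk Sk kE]]; have [k' dk' k'E] := lift_coc dk Sk.
exists (g \- (k' \o prd Q a)); split=> /= [|x|x].
- apply: homdegB => //; rewrite -[j]add0r; apply: homdeg_comp => //.
  exact: prd_deg.
- by apply/uK; rewrite linearB /= k'E -kE subrr.
- by rewrite prd_prd linear0 subr0 gE.
Qed.

(** Exactness at H^a(X): the image of a cocycle in [S] bounds, and subtracting the coboundary of a
    lifted primitive leaves a cocycle with values in [K]. *)
Lemma hvan_mid a : hvan Q j S a -> hzero Q j K a -> hvan Q j (@setT X) a.
Proof.
move=> hS hK f [df _ cf].
have : hcob j S (u \o f).
  apply: hS; split=> [|x|x] /=.
  - by rewrite -[j]addr0; apply: homdeg_comp.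
  - by apply/uS; exists (f x).
  - by rewrite cf linear0.
case: a hS hK f df cf => [|a] hS hK f df cf.
  by move=> uf; apply: (hK f); split=> // x; apply/uK; apply: uf.
move=> [k [dk Sk kE]]; have [k' dk' k'E] := lift_coc dk Sk.
have dkp : homdeg j (k' \o prd Q a).
  by rewrite -[j]add0r; apply: homdeg_comp => //; apply: prd_deg.
have [|g [dg _ gE]] := hK (f \- (k' \o prd Q a)).
  split=> [|x|x] /=.
  - exact: homdegB.
  - by apply/uK; rewrite linearB /= k'E -kE subrr.
  - by rewrite cf prd_prd linear0 subr0.
exists (g \+ k'); split=> //=; first exact: homdegD.
by move=> x; rewrite -gE subrK.
Qed.

End LongExactSequence.

(** * Ext by injective resolutions agrees with Ext by projective resolutions *)

Section Balancing.
Variable B : grRing.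

Lemma factor_surj (X Y Z : grMod B) (u : {linear X -> Y}) (f : {linear X -> Z})
    j :
  homdeg 0 u -> homdeg j f -> (forall y, exists x, u x = y) ->
  (forall x, u x = 0 -> f x = 0) ->
  exists2 k : {linear Y -> Z}, homdeg j k & forall x, k (u x) = f x.
Proof.
move=> du df us uf.
have ufE x y : u x = u y -> f x = f y.
  move=> e; apply/eqP; rewrite -subr_eq0 -linearB /=; apply/eqP/uf.
  by rewrite linearB /= e subrr.
have /choice[s sE] := us.
have kl : linear (fun y => f (s y)).
  move=> a x y; rewrite -linearP; apply: ufE.
  by rewrite linearP !sE.
exists (mklin kl); last by move=> x; apply: ufE; rewrite sE.
move=> i y gy; rewrite -[mklin kl y]/(f (s y)).
have -> : f (s y) = f (mcmp i (s y)).
  apply: ufE; rewrite -(mcmp_hom _ _ du) sE addr0 /mcmp cmp_id //.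
by apply: df; apply: mcmp_in.
Qed.

Variables (N M : grMod B) (Q : projres N) (I : injres M) (j : int).

(** The [b]-th cosyzygy of [M]: the image of the map entering [I b], which for [b = 0] is a copy of
    [M]. *)
Let S b : set (I b) := [set x | ird I b x = 0].

Let hvanI b a : hvan Q j (@setT (I b)) a.+1.
Proof.
move=> f [df _ cf].
have [|g [dg gE]] := inj_ext (@ir_inj _ _ I b) (@prd_deg _ _ Q a) df.
  move=> x px; have [y ->] : exists y, x = prd Q a.+1 y.
    exact/(pr_exactS (p := Q)).
  exact: cf.
by exists g; split=> // x; rewrite gE.
Qed.

(** The sequence 0 -> S b -> I b -> S (b+1) -> 0 shifts the cohomological degree, since the
    injective module [I b] has no cohomology in positive degrees. *)
Let shiftS b a : hvan Q j (@S b) a.+2 <-> hvan Q j (@S b.+1) a.+1.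
Proof.
have uS y : S y <-> exists x, y = ird I b x by apply: (ir_exactS (i := I)).
have uK x : ird I b x = 0 <-> S x by [].
split=> h; first exact: (hvan_quot (@ird_deg _ _ I b) uK uS).
apply: (hvan_ker (@ird_deg _ _ I b) uK uS) => //.
exact: hvanT_hzero.
Qed.

Let shiftSn b a : hvan Q j (@S b) a.+1 <-> hvan Q j (@S (b + a)) 1.
Proof.
elim: a b => [|a IH] b; first by rewrite addn0.
rewrite addnS -addSn -IH; exact: shiftS.
Qed.

Let hvan_S0 a : hvan Q j (@setT M) a <-> hvan Q j (@S 0) a.
Proof.
have uS y : @S 0 y <-> exists x, y = ira I x by apply: (ir_exact0 (i := I)).
have uK x : ira I x = 0 <-> x = 0.
  split=> [|->]; last exact: linear0.
  by rewrite -[X in _ = X](linear0 (ira I)); apply: ira_inj.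
have K0 c : hvan Q j [set x : M | x = 0] c by apply: hvan0.
split=> h; first by apply: (hvan_quot (@ira_deg _ _ I) uK uS) => //.
apply: (hvan_mid (@ira_deg _ _ I) uK uS) => //.
exact: hvan_hzero.
Qed.

Let hfactor (X : grMod B) (f : {linear Q 0 -> X}) : homdeg j f ->
  (forall x, f (prd Q 0 x) = 0) ->
  exists2 k : {linear N -> X}, homdeg j k & forall x, k (pra Q x) = f x.
Proof.
move=> df cf; apply: factor_surj => //; first exact: pra_deg.
  exact: pra_surj.
move=> x px; have [y ->] : exists y, x = prd Q 0 y.
  exact/(pr_exact0 (p := Q)).
exact: cf.
Qed.

Let pra_prd x : pra Q (prd Q 0 x) = 0.
Proof. by apply/(pr_exact0 (p := Q)); exists x. Qed.

Let praj : homdeg 0 (pra Q).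
Proof. exact: pra_deg. Qed.

(** Shifting along the cosyzygies of [M] reduces the right side to H^1 with values in [S b] for
    [q = b.+1], or to H^0 with values in [S 0] for [q = 0]. There, maps from [Q 0] that vanish on
    the image of [Q 1] are maps from [N], which gives the comparison with Hom(N, I). *)
Lemma ext_zero_hvan q : ext_zero N I q j <-> hvan Q j (@setT M) q.
Proof.
rewrite hvan_S0; case: q => [|b].
  split=> [h f [df Sf cf]|h f [df zf]].
    have [k dk kE] := hfactor df cf.
    move=> x /=; rewrite -kE; apply: (h k); split=> // y.
    by have [z <-] := pra_surj Q y; rewrite kE; apply: Sf.
  move=> y; have [z <-] := pra_surj Q y.
  apply: (h (f \o pra Q)); split=> [|x|x] /=.
  - by rewrite -[j]add0r; apply: homdeg_comp.
  - exact: zf.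
  - by rewrite pra_prd linear0.
rewrite shiftSn add0n.
split=> [h f [df Sf cf]|h f [df zf]].
  (* Inside [I b] the cocycle [f] bounds some [g]; then [ird I b \o g] descends to a cocycle on [N],
     and a primitive [k'] of it corrects [g] to have values in [S b]. *)
  have [|g [dg _ gE]] := hvanI (b := b) (a := 0) (f := f); first by split.
  have dug : homdeg j (ird I b \o g).
    by rewrite -[j]addr0; apply: homdeg_comp => //; apply: ird_deg.
  have [|k dk kE] := hfactor dug; first by move=> x /=; rewrite -gE; apply: Sf.
  have [|k' [dk' k'E]] := h k.
    split=> // y; have [z <-] := pra_surj Q y; rewrite kE /=.
    by apply/(ir_exactS (i := I)); exists (g z).
  exists (g \- (k' \o pra Q)); split=> [|x|x] /=.
  - by apply: homdegB => //; rewrite -[j]add0r; apply: homdeg_comp.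
  - by rewrite /S /= linearB /= -k'E kE subrr.
  - by rewrite pra_prd linear0 subr0 gE.
have uS y : @S b.+1 y <-> exists x, y = ird I b x.
  exact: (ir_exactS (i := I)).
have dfp : homdeg j (f \o pra Q) by rewrite -[j]add0r; apply: homdeg_comp.
(* Conversely, the cocycle [f] on [N], pulled back to [Q 0], lifts to [h0] with values in [I b]; its
   coboundary takes values in [S b], and once [h0] is corrected by an [S b]-valued primitive it
   descends to [N]. *)
have [|h0 dh0 h0E] := lift_coc (@ird_deg _ _ I b) uS dfp.
  by move=> x; apply: zf.
have [|g [dg Sg gE]] := h (h0 \o prd Q 0).
  split=> [|x|x] /=.
  - by rewrite -[j]add0r; apply: homdeg_comp => //; apply: prd_deg.
  - by rewrite /S /= h0E /= pra_prd linear0.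
  - by rewrite prd_prd linear0.
have [||k dk kE] := hfactor (f := h0 \- g); first exact: homdegB.
  by move=> x /=; rewrite -gE subrr.
exists k; split=> // y; have [z <-] := pra_surj Q y.
by rewrite kE /= linearB /= h0E (Sg z : ird I b (g z) = 0) subr0.
Qed.

End Balancing.

(** * Cohomology with coefficients in a free module *)

Section FreeCoefficients.
Variables (B : grRing) (N : grMod B) (Q : projres N).

Section Coordinates.
Variables (n : nat) (b : 'I_n -> int).

Lemma coord_lin k : linear (fun x : free B b => x k : regular B).
Proof. by move=> a x y; rewrite !ffunE. Qed.

Definition fr_coord k : {linear free B b -> regular B} := mklin (coord_lin k).

Lemma fr_coord_deg k : homdeg (- b k) (fr_coord k).
Proof. by move=> i x gx; apply: gx. Qed.

Lemma fr_inj_lin (c : B) k :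
  linear (fun x : regular B => ((x : B) * c) *: fr_e B b k).
Proof. by move=> a x y; rewrite scalerA mulrA -scalerDl -mulrDl. Qed.

Definition fr_inj c k : {linear regular B -> free B b} :=
  mklin (fr_inj_lin c k).

Lemma fr_inj_deg c k e : grR (e - b k) c -> homdeg e (fr_inj c k).
Proof.
move=> gc i x gx; have -> : i + e = i + (e - b k) + b k by rewrite addrA subrK.
by apply: grM_Z; [apply: grR_M|apply: fr_e_deg].
Qed.

End Coordinates.

Lemma hcob_sum j (X : grMod B) a (J : Type) (r : seq J) (F : J -> Q a -> X) :
  (forall i, hcob j setT (F i)) -> hcob j setT (fun x => \sum_(i <- r) F i x).
Proof.
move=> hF; elim: r => [|i r IH].
  by apply: hcob0 => // x; rewrite big_nil.
apply: (@hcob_ext _ _ _ j _ _ _ (F i \+ (fun x => \sum_(i <- r) F i x))).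
  by move=> x; rewrite big_cons.
exact: hcobD.
Qed.

(** Cohomology commutes with finite direct sums, and the [k]-th summand is the regular module with
    its degrees shifted by [b k]. *)
Lemma hvan_free j n (b : 'I_n -> int) a :
  hvan Q j (@setT (free B b)) a <->
  forall k, hvan Q (j - b k) (@setT (regular B)) a.
Proof.
split=> [h k f [df _ cf]|h f [df _ cf]].
  have gk : grR (b k - b k) (1 : B) by rewrite subrr; apply: grR_1.
  have : hcob j setT (fr_inj b 1 k \o f).
    apply: h; split=> // [|x]; last by rewrite [LHS]/= cf mul0r scale0r.
    by rewrite -[j](subrK (b k)); apply: homdeg_comp => //; apply: fr_inj_deg.
  move=> hf; have := hcob_comp (S := setT) (@fr_coord_deg _ b k) (fun=> I) hf.
  apply: hcob_ext => x.
  rewrite -[LHS]/((((f x : B) * 1) *: fr_e B b k : free B b) k) !ffunE eqxx.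
  by rewrite mulr1; apply: mulr1.
have hk k : hcob j setT (fr_inj b 1 k \o (fr_coord b k \o f)).
  rewrite -[j](subrK (b k)); apply: hcob_comp => //.
    by apply: fr_inj_deg; rewrite subrr; apply: grR_1.
  apply: h; split=> // [|x]; last by rewrite /= cf ffunE.
  by apply: homdeg_comp => //; apply: fr_coord_deg.
apply: hcob_ext (hcob_sum (index_enum _) hk) => x.
rewrite [RHS]fr_sum; apply: eq_bigr => k _.
by rewrite -[LHS]/((((f x : free B b) k : B) * 1) *: fr_e B b k) mulr1.
Qed.

Variables (d : nat) (l : int).
Hypothesis (hA0 : forall a j, (a, j) <> (d, - l) ->
  hvan Q j (@setT (regular B)) a).

(** The map [u] is the sum of its matrix entries [c i k], of degree [b' i - b k]. An entry of degree
    0 vanishes by minimality. For any other entry, source and target summand cannot both have their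
    cohomology in degree [j], as it sits in the single internal degree [- l] of the regular
    module. *)
Lemma hcob_minimal j n (b : 'I_n -> int) n' (b' : 'I_n' -> int)
    (u : {linear free B b' -> free B b}) (h : {linear Q d -> free B b'}) :
  homdeg 0 u -> (forall x k, rcmp 0 (u x k : B) = 0) -> hcoc j setT h ->
  hcob j setT (u \o h).
Proof.
move=> du umin [dh _ ch].
pose c i k : B := u (fr_e B b' i) k.
have gc i k : grR (b' i - b k) (c i k).
  by have := du _ _ (@fr_e_deg B _ b' i); rewrite addr0; apply.
have dhi i : hcoc (j - b' i) setT (fr_coord b' i \o h).
  split=> // [|x]; last by rewrite /= ch ffunE.
  by apply: homdeg_comp => //; apply: fr_coord_deg.
have cob i k : hcob j setT (fr_inj b (c i k) k \o (fr_coord b' i \o h)).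
  have [bik|bik] := eqVneq (b' i) (b k).
    have c0 : c i k = 0.
      have := umin (fr_e B b' i) k; rewrite /rcmp cmp_id //.
      by have := gc i k; rewrite bik subrr.
    apply: hcob0 => // x.
    rewrite -[LHS]/((_ * c i k) *: fr_e B b k) c0 mulr0 scale0r //.
  (* Here the source summand has cohomology in degree [j]; the target, taken as a free module of
     rank one on a generator of degree [b k], then has none. *)
  have [bl|bl] := eqVneq (j - b' i) (- l).
    pose v := fr_inj (fun=> b k : int) (c i k) (@ord0 0).
    have dv : homdeg (b' i) v by apply: fr_inj_deg; apply: gc.
    have hv : hcob j setT (v \o (fr_coord b' i \o h)).
      have := @hvan_free j 1 (fun=> b k) d; case=> _; apply.
        move=> _; apply: hA0 => -[] /eqP; rewrite -bl (inj_eq (addrI j)).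
        by rewrite eqr_opp eq_sym (negPf bik).
      have [dhi' _ chi] := dhi i; split=> // [|x].
        by rewrite -[j](subrK (b' i)); apply: (homdeg_comp dhi' dv).
      by rewrite [LHS]/= ch ffunE mul0r scale0r.
    have fd : homdeg 0 (frmap (fun _ : 'I_1 => b k) (fun=> fr_e B b k)).
      by apply: frmap_deg => _; rewrite addr0; apply: fr_e_deg.
    have := hcob_comp (S := setT) fd (fun=> I) hv.
    rewrite addr0; apply: hcob_ext => x.
    rewrite -[LHS]/(frmap _ _ (((h x i : B) * c i k) *: fr_e _ _ ord0)).
    by rewrite linearZ frmap_e.
  (* In the remaining case it is the source summand that has no cohomology. *)
  rewrite -[j](subrK (b' i)); apply: hcob_comp => //; first exact: fr_inj_deg.
  by apply: hA0 (dhi i) => -[] /eqP; rewrite (negPf bl).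
have cobi i := hcob_sum (index_enum _) (cob i).
apply: hcob_ext (hcob_sum (index_enum _) cobi) => x.
rewrite /= [in RHS](fr_sum (h x)) linear_sum; apply: eq_bigr => i _.
rewrite linearZ /= [in RHS](fr_sum (u _)) scaler_sumr; apply: eq_bigr => k _.
by rewrite scalerA.
Qed.

End FreeCoefficients.

(** * Ext(k, M) from a minimal resolution of M *)

Section ExtMinimal.
Variables (B : grRing) (N M : grMod B) (Q : projres N) (F : minres M).
Variables (d : nat) (l : int) (n : nat).
Hypothesis (hA0 : forall a j, (a, j) <> (d, - l) ->
  hvan Q j (@setT (regular B)) a).
Hypothesis (hA1 : ~ hvan Q (- l) (@setT (regular B)) d).
Hypothesis (hn : forall i, (n < i)%N -> 'I_(mr_n F i) -> False).

Let FF i : grMod B := free B (@mr_b _ _ F i).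

(** The syzygy of [M] of index i+1, as a subset of the [i]-th free module. *)
Let K i : set (FF i) :=
  match i with
  | 0 => [set x | mr_a F x = 0]
  | i'.+1 => [set x | mr_d F i' x = 0]
  end.

Let K_im i y : K y <-> exists x, y = mr_d F i x.
Proof. by case: i y => [|i] y; [apply: mr_exact0|apply: mr_exactS]. Qed.

Let K_min i x : @K i x -> forall k, rcmp 0 (x k : B) = 0.
Proof. by case: i x => [|i] x; [apply: mr_min0|apply: mr_minS]. Qed.

Section Degree.
Variable j : int.

(* Vanishing for the i-th syzygy of M. *)
Let hK i a : Prop :=
  match i with
  | 0 => hvan Q j (@setT M) a
  | i'.+1 => hvan Q j (@K i') a
  end.

Let d_im i : forall y, @K i y <-> exists x, y = mr_d F i x.
Proof. exact: K_im. Qed.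

Let a_im y : @setT M y <-> exists x, y = mr_a F x.
Proof. by split=> // _; have [x <-] := mr_surj F y; exists x. Qed.

Let hK_quot i a : hvan Q j (@setT (FF i)) a -> hvan Q j (@K i) a.+1 -> hK i a.
Proof.
case: i => [|i]; first exact: (hvan_quot (@mr_adeg _ _ F) _ a_im).
exact: (hvan_quot (@mr_ddeg _ _ F i) _ (@d_im i)).
Qed.

Let hK_ker i a : hK i a -> hzero Q j (@K i) a.+1 -> hvan Q j (@K i) a.+1.
Proof.
case: i => [|i]; first exact: (hvan_ker (@mr_adeg _ _ F) _ a_im).
exact: (hvan_ker (@mr_ddeg _ _ F i) _ (@d_im i)).
Qed.

Let hK_mid i a : hK i a -> hzero Q j (@K i) a -> hvan Q j (@setT (FF i)) a.
Proof.
case: i => [|i]; first exact: (hvan_mid (@mr_adeg _ _ F) _ a_im).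
exact: (hvan_mid (@mr_ddeg _ _ F i) _ (@d_im i)).
Qed.

Let hvanF i a : a <> d -> hvan Q j (@setT (FF i)) a.
Proof. by move=> ad; apply/hvan_free => k; apply: hA0 => -[]. Qed.

Let hvanFd i : hvan Q j (@setT (FF i)) d <->
  forall k, mr_b (m := F) (i := i) k <> j + l.
Proof.
rewrite hvan_free; split=> h k.
  move=> e; apply: hA1; have := h k.
  by rewrite e opprD addrA subrr add0r.
apply: hA0 => -[/eqP]; rewrite subr_eq addrC -subr_eq opprK eq_sym => /eqP e.
exact: (h k).
Qed.

(** Descending induction on the index, starting beyond the length of [F], where syzygies are zero:
    [K i] is the quotient of the next free module, without cohomology in degrees above [d], by
    [K i.+1]. *)
Let hvanK_gt i a : (d < a)%N -> hvan Q j (@K i) a.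
Proof.
have [m] : exists m, (n < i + m)%N by exists n.+1; rewrite addnS ltnS leq_addl.
elim: m i a => [|m IH] i a nim da.
  apply: hvan0.
    by case: (i) => [|i']; rewrite /K /= linear0.
  move=> x _; apply/ffunP => k; have := hn _ k; rewrite addn0 in nim.
  by move=> /(_ nim).
apply: (@hK_quot i.+1); first by apply: hvanF => ad; rewrite ad ltnn in da.
by apply: IH; [rewrite addSnnS|apply: ltnW].
Qed.

(** Away from degree [d] the free module has no cohomology. In degree [d], a cocycle with values in
    [K i] lifts to the next free module because H^(d+1) of [K i.+1] vanishes, and the differential
    induces zero on H^d by minimality. *)
Let hzeroK i a : hzero Q j (@K i) a.
Proof.
have [->|/eqP ad] := eqVneq a d; last by apply: hvanT_hzero; apply: hvanF.
have dK x : mr_d F i x = 0 <-> @K i.+1 x by [].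
move=> f /(hvan_lift (@mr_ddeg _ _ F i) dK (@d_im i) (@hvanK_gt _ _ (ltnSn d))).
move=> [h ch fh].
apply: (@hcob_ext _ _ _ j _ _ _ (mr_d F i \o h)) => [x|]; first by rewrite fh.
apply: (hcob_minimal hA0 (@mr_ddeg _ _ F i)) => // x k.
by apply: (@K_min i); apply/d_im; exists x.
Qed.

Let hK_step i a : hK i a -> hK i.+1 a.+1.
Proof. by move=> h; apply: hK_ker h _; apply: hzeroK. Qed.

Let hK_iter i q m : hK i q -> hK (i + m) (q + m).
Proof.
by move=> h; elim: m => [|m IH]; rewrite ?addn0 // !addnS; apply: hK_step.
Qed.

(** Vanishing for [M] in degree [q] passes to the [i]-th syzygy in degree q+i. When this is [d], it
    implies vanishing for the [i]-th free module, whose cohomology is read off its generators. The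
    converse goes back along the same sequences. *)
Lemma hvan_minres q : hvan Q j (@setT M) q <->
  forall i, (q + i = d)%N -> forall k, mr_b (m := F) (i := i) k <> j + l.
Proof.
split=> [h i qi|h].
  apply/hvanFd; have /= := @hK_iter 0 q i h; rewrite qi add0n => /hK_mid; apply.
  exact: hzeroK.
have [qd|dq] := leqP q d; last first.
  apply: (@hK_quot 0); last by apply: hvanK_gt; apply: ltnW.
  by apply: hvanF => e; rewrite e ltnn in dq.
(* Induction on the distance [m] from q+i to [d]; before [d] the free modules have no cohomology. *)
suff hi m i : (q + i + m = d)%N -> hK i (q + i).
  by have := hi (d - q)%N 0%N; rewrite addn0; apply; apply: subnKC.
elim: m i => [|m IH] i qid.
  rewrite addn0 in qid; apply: hK_quot; last by apply: hvanK_gt; rewrite qid.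
  by rewrite qid; apply/hvanFd; apply: h.
apply: hK_quot.
  apply: hvanF => e; have := qid; rewrite e => /eqP.
  by rewrite -[X in _ == X]addn0 eqn_add2l.
by have := IH i.+1; rewrite addnS; apply; rewrite addSnnS.
Qed.

(** The syzygy of index i-d is a submodule of a free module. Since H^0 is left exact, [hzeroK] makes
    its H^0 vanish; [d] shifts later this gives vanishing of H^d for the [i]-th free module. *)
Lemma minres_no_gens i : (d < i)%N ->
  forall k, mr_b (m := F) (i := i) k <> j + l.
Proof.
move=> di; apply/hvanFd; have : hK (i - d) 0.
  have : (0 < i - d)%N by rewrite subn_gt0.
  by case: (i - d)%N => // m _; apply: hzero_hvan0; apply: hzeroK.
move=> /(@hK_iter _ _ d); rewrite subnK ?(ltnW di) // add0n => /hK_mid; apply.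
exact: hzeroK.
Qed.

End Degree.

Lemma minres_length i : 'I_(mr_n F i) -> (i <= d)%N.
Proof.
move=> k; rewrite leqNgt; apply/negP => di.
by apply: (@minres_no_gens (mr_b k - l) i di k); rewrite subrK.
Qed.

End ExtMinimal.

(** * Tor from a minimal resolution *)

Section Comparison.
Variables (B : grRing) (M : grMod B).

Definition chain_map (P P' : projres M) (f : forall i, {linear P i -> P' i}) :
    Prop :=
  [/\ forall i, homdeg 0 (f i), forall x, pra P' (f 0%N x) = pra P x &
      forall i x, prd P' i (f i.+1 x) = f i (prd P i x)].

Lemma chain_map_exists (P P' : projres M) : exists f, @chain_map P P' f.
Proof.
(* Of the commutation with differentials, [good] keeps only what the next lift needs, so that it
   does not mention the preceding map. *)
pose good i (f : {linear P i -> P' i}) := homdeg 0 f /\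
  match i return {linear P i -> P' i} -> Prop with
  | 0 => fun f => forall x, pra P' (f x) = pra P x
  | i'.+1 => fun f => forall x, prd P' i' (f (prd P i'.+1 x)) = 0
  end f.
have start : exists f, @good 0%N f.
  have [|f [df fE]] :=
    proj_lift (@pr_proj _ _ P 0%N) (@pra_deg _ _ P') (@pra_deg _ _ P).
    by move=> p; have [x ex] := pra_surj P' (pra P p); exists x.
  by exists f.
have goodex i (f : {linear P i -> P' i}) : good i f ->
    forall p, exists x, f (prd P i p) = prd P' i x.
  case: i f => [|i] f [df fE] p.
    apply/(pr_exact0 (p := P')); rewrite fE.
    by apply/(pr_exact0 (p := P)); exists p.
  by apply/(pr_exactS (p := P')).
have step i (f : {linear P i -> P' i}) : good i f ->
    exists g, good i.+1 g /\ forall x, prd P' i (g x) = f (prd P i x).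
  move=> gf; have [df _] := gf.
  have dfp : homdeg 0 (f \o prd P i).
    by rewrite -[0]addr0; apply: homdeg_comp => //; apply: prd_deg.
  have [g [dg gE]] :=
    proj_lift (@pr_proj _ _ P i.+1) (@prd_deg _ _ P' i) dfp (goodex i f gf).
  exists g; split=> //; split=> // x; rewrite gE /=.
  by rewrite prd_prd linear0.
pose T i := {f : {linear P i -> P' i} | good i f}.
pose nxt i (t : T i) : T i.+1 :=
  exist _ _ (proj1 (projT2 (cid (step i _ (proj2_sig t))))).
pose F := fix F i : T i := match i return T i with
  | 0 => exist _ _ (projT2 (cid start)) | i'.+1 => nxt i' (F i') end.
exists (fun i => proj1_sig (F i)); split.
- by move=> i; case: (proj2_sig (F i)).
- by case: (proj2_sig (F 0%N)).
- by move=> i x; rewrite /= ; case: cid => g [] /=.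
Qed.

(** The homotopy is produced only around one index, together with the preceding map [s']; this
    suffices to compare homology classes at that index. *)
Lemma homotopy_id (P : projres M) f : @chain_map P P f -> forall i,
  exists s : {linear P i -> P i.+1}, homdeg 0 s /\
  match i return {linear P i -> P i.+1} -> Prop with
  | 0 => fun s => forall x, prd P 0 (s x) = x - f 0%N x
  | i'.+1 => fun s => exists s' : {linear P i' -> P i'.+1}, homdeg 0 s' /\
      forall x, prd P i'.+1 (s x) = x - f i'.+1 x - s' (prd P i' x)
  end s.
Proof.
move=> [df f0 fS]; elim=> [|i [s [ds sE]]].
  have [||s [ds sE]] := proj_lift (j := 0) (f := idfun \- f 0%N)
    (@pr_proj _ _ P 0%N) (@prd_deg _ _ P 0%N).
  - by apply: homdegB => // j x; rewrite addr0.
  - move=> x; apply/(pr_exact0 (p := P)).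
    by rewrite /= linearB /= f0 subrr.
  by exists s; split.
have dsp : homdeg 0 (s \o prd P i).
  by rewrite -[0]addr0; apply: homdeg_comp => //; apply: prd_deg.
have [||s' [ds' sE']] :=
  proj_lift (j := 0) (f := (idfun \- f i.+1) \- (s \o prd P i))
    (@pr_proj _ _ P i.+1) (@prd_deg _ _ P i.+1).
- by apply: homdegB => //; apply: homdegB => // j x; rewrite addr0.
- move=> x; apply/(pr_exactS (p := P)); rewrite /= !linearB /= fS.
  case: i s ds sE {dsp} x => [|i] s ds sE x; first by rewrite sE subrr.
  by case: sE => s' [ds' ->]; rewrite prd_prd linear0 subr0 subrr.
by exists s'; split=> //; exists s.
Qed.

Variable N : grMod (grop B).

Lemma balanced_comp (P Q : grMod B) (f : {linear P -> Q}) (V : zmodType)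
    (b : N -> Q -> V) : balanced b -> balanced (fun x p => b x (f p)).
Proof.
move=> [bl br bm]; split=> [x y p|x p q|a x p]; first exact: bl.
  by rewrite linearD br.
by rewrite linearZ bm.
Qed.

Lemma tens_deg_map (P Q : grMod B) (f : P -> Q) (s : seq (N * P)) j :
  homdeg 0 f -> tens_deg j s -> tens_deg j (tens_map f s).
Proof.
move=> df ds u /mapP[v vs ->]; have [p [q [gp gq pq]]] := ds v vs.
by exists p, q; split=> //=; have := df _ _ gq; rewrite addr0.
Qed.

Lemma balanced0r (P : grMod B) (V : zmodType) (b : N -> P -> V) x :
  balanced b -> b x 0 = 0.
Proof. by case=> _ br _; apply: (addrI (b x 0)); rewrite -br !addr0. Qed.

Lemma balanced0l (P : grMod B) (V : zmodType) (b : N -> P -> V) p :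
  balanced b -> b 0 p = 0.
Proof. by case=> bl _ _; apply: (addrI (b 0 p)); rewrite -bl !addr0. Qed.

Lemma balancedBr (P : grMod B) (V : zmodType) (b : N -> P -> V) x p q :
  balanced b -> b x (p - q) = b x p - b x q.
Proof. by case=> _ br _; apply/eqP; rewrite eq_sym subr_eq -br subrK. Qed.

(** A chain map and one in the opposite direction compose to a map homotopic to the identity, so a
    class whose image is a boundary is itself a boundary. *)
Lemma tor_supp_sub (P P' : projres M) i j :
  tor_supp N P i j -> tor_supp N P' i j.
Proof.
have [f [df f0 fS]] := chain_map_exists P P'.
have [g [dg g0 gS]] := chain_map_exists P' P.
have cgf : @chain_map P P (fun i => g i \o f i).
  split=> [k|x|k x] /=; last by rewrite gS fS.
    by rewrite -[0]addr0; apply: homdeg_comp.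
  by rewrite g0 f0.
move=> [s sZ sB]; exists (tens_map (f i) s).
  case: i s sZ {sB} => [|i] s /=; first exact: tens_deg_map.
  move=> [dgs es]; split; first exact: tens_deg_map.
  move=> V b hb; rewrite /tens_map !big_map big_nil /=.
  under eq_bigr do rewrite fS.
  by have := es V _ (balanced_comp (f i) hb); rewrite /tens_map big_map big_nil.
move=> [t dgt et]; apply: sB.
have dgs : tens_deg j s by case: i s sZ {t dgt et} => [|i] s // [].
have [h [dh hE]] := homotopy_id cgf i.
(* From s - g(f(s)) = d(h(s)) + h'(d(s)), where d(s) = 0 and f(s) = d(t), follows s = d(h(s) +
   g(t)). *)
exists (tens_map h s ++ tens_map (g i.+1) t).
  move=> u; rewrite mem_cat => /orP[]; exact: tens_deg_map.
move=> V b hb; rewrite /tens_map map_cat big_cat !big_map /=.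
have e1 : \sum_(u <- t) b u.1 (prd P i (g i.+1 u.2)) =
    \sum_(u <- s) b u.1 (g i (f i u.2)).
  have := et V _ (balanced_comp (g i) hb); rewrite /tens_map !big_map /= => ->.
  by apply: eq_bigr => u _; rewrite gS.
rewrite e1 -big_split /=.
case: i s h b hb sZ dgs dh hE {t dgt et e1} => [|i] s h b hb sZ dgs dh hE.
  by apply: eq_bigr => u _; rewrite hE /= balancedBr // subrK.
have [h' [dh' hE']] := hE; have [_ es] := sZ.
have := es V _ (balanced_comp h' hb).
rewrite /tens_map big_map big_nil /= => e2.
rewrite -[LHS]subr0 -[X in _ - X]e2 -sumrB; apply: eq_bigr => u _.
by rewrite hE' /= !balancedBr // addrAC subrK.
Qed.

End Comparison.

Section TorMinimal.
Variable B : grRing.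

Lemma tailMr n (a x : B) : tail n x -> tail n (x * a).
Proof.
move=> [s [f [sf ->]]]; have ds := grR_ds B.
have : gsum (@grR B) setT a by rewrite ds_span.
move=> [t [h [th ->]]]; rewrite mulr_suml big_seq_cond.
apply: (gsum_sum ds) => i /andP[/sf[ni fi] _]; rewrite mulr_sumr big_seq_cond.
apply: (gsum_sum ds) => j /andP[/th[_ hj] _].
have [j0|j0] := ltP j 0; first by rewrite (grR_neg j0 hj) mulr0; apply: gsum0.
by apply: (@gsum1 _ _ _ (i + j)); [rewrite /= ler_wpDr|apply: grR_M].
Qed.

Lemma tailP n (a : B) : tail n a <-> forall j, j < n%:Z -> rcmp j a = 0.
Proof.
rewrite /tail (gsum_cmp (grR_ds B)); split=> h j jn; apply: h => /=.
  by rewrite leNgt jn.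
by rewrite ltNge; apply/negP.
Qed.

Lemma rcmp_neg j (a : B) : j < 0 -> rcmp j a = 0.
Proof. by move=> j0; apply: (grR_neg j0); apply: rcmp_in. Qed.

Lemma tail1P (a : B) : tail 1 a <-> rcmp 0 a = 0.
Proof.
rewrite tailP; split=> [->//|a0 j].
rewrite -[1%:Z]/((0 : int) + 1) ltzD1 le_eqVlt => /orP[/eqP->//|].
exact: rcmp_neg.
Qed.

Lemma rcmp01 : rcmp 0 (1 : B) = 1.
Proof. by rewrite /rcmp cmp_id //; apply: grR_1. Qed.

Lemma kmod_scale0 (c : B) (q : kmod B) : tail 1 c -> c *: q = 0.
Proof.
move=> tc; have -> : q = tpi 1 (repr (q : tquot B 1)) by rewrite tpi_repr.
rewrite [LHS]tscale_pi -[RHS](@tpi0 B 1); apply/tpi_eq; rewrite subr0.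
exact: tailMr.
Qed.

Lemma kmod_deg (q : kmod B) j : grM j q -> j <> 0 -> q = 0.
Proof.
move=> [a ga ->] j0; rewrite -[RHS](@tpi0 B 1); apply/tpi_eq; rewrite subr0.
by apply/tail1P; rewrite /rcmp (cmp_homog _ _ ga) eq_sym; case: eqP.
Qed.

End TorMinimal.

Section TorMinres.
Variables (B : grRing) (M : grMod B) (F : minres M).
Let N := kmod (grop B).
Let P := minres_projres F.

Lemma minres_min i (x : P i.+1) k : rcmp 0 (prd P i x k : B) = 0.
Proof.
case: i x k => [|i] x k.
  by apply: mr_min0; apply/mr_exact0; exists x.
by apply: mr_minS; apply/mr_exactS; exists x.
Qed.

Lemma grop_tail n (c : B) : tail n c -> @tail (grop B) n c.
Proof. by []. Qed.

Lemma kmod_scaler0 (c : B) (q : N) : rcmp 0 c = 0 -> (c : grop B) *: q = 0.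
Proof. by move=> c0; apply: kmod_scale0; apply: grop_tail; apply/tail1P. Qed.

Lemma balanced_free (V : zmodType) i (b : N -> P i -> V) x (p : P i) :
  balanced b -> b x p = \sum_k b ((p k : grop B) *: x) (fr_e _ _ k).
Proof.
move=> hb; have [bl br bm] := hb; rewrite {1}(fr_sum p).
rewrite (big_morph (b x) (br x) (balanced0r x hb)).
by apply: eq_bigr => k _; rewrite bm.
Qed.

(** By minimality the differential of the complex obtained from [F] by tensoring with k is zero. A
    homogeneous pure tensor of degree [j] vanishes when no generator has degree [j]: its left factor
    is zero or of degree 0, and coordinates of nonzero degree act as zero on it. *)
Lemma tor_supp_minres i j : tor_supp N P i j <-> exists k, @mr_b _ _ F i k = j.
Proof.
split=> [[s sZ sB]|[k bk]].
  apply: contrapT => nk; apply: sB; exists [::] => // V b hb.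
  have ds : tens_deg j s by case: i s sZ {b hb nk} => [|i] s // [].
  rewrite big_nil big_seq big1 // => u /ds[p [q [gp gq pq]]].
  rewrite (balanced_free _ _ hb) big1 // => k _.
  suff -> : (u.2 k : grop B) *: u.1 = 0 by apply: balanced0l.
  have [p0|/eqP p0] := eqVneq p 0; last by rewrite (kmod_deg gp p0) scaler0.
  apply: kmod_scaler0; have := gq k; rewrite /rcmp => gqk.
  rewrite (cmp_homog _ _ gqk) eq_sym subr_eq0; case: eqP => // e.
  by case: nk; exists k; rewrite -pq p0 add0r e.
pose o : N := tpi 1 (1 : grop B).
exists [:: (o, fr_e _ _ k : P i)].
  have dg : tens_deg j [:: (o, fr_e _ _ k : P i)].
    move=> u; rewrite inE => /eqP -> /=.
    exists 0, j; split; last by rewrite add0r.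
      by exists 1 => //; apply: (@grR_1 (grop B)).
    by rewrite -bk; apply: fr_e_deg.
  case: i k bk dg => [|i] k bk dg //; split=> // V b hb.
  rewrite /tens_map /= big_seq1 big_nil /= (balanced_free _ _ hb).
  rewrite big1 // => m _.
  by rewrite kmod_scaler0 ?balanced0l //; apply: minres_min.
(* Reading off the [k]-th coordinate is a balanced map that kills boundaries and sends the candidate
   tensor to the class of 1. *)
have hb : balanced (fun (x : N) (p : P i) => (p k : grop B) *: x).
  split=> [x y p|x p q|a x p].
  - exact: scalerDr.
  - by rewrite ffunE; apply: (@scalerDl (grop B)).
  - by rewrite scalerA ffunE.
move=> [t _ /(_ N _ hb)].
rewrite big_seq1 /tens_map big_map [RHS]big1 => [|u _]; last first.
  by apply: kmod_scaler0; apply: minres_min.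
rewrite /= ffunE eqxx scale1r -[X in _ = X](@tpi0 (grop B) 1) => /tpi_eq.
rewrite subr0 => /(tail1P (B := grop B)); rewrite rcmp01 => /eqP.
by rewrite oner_eq0.
Qed.

End TorMinres.

(** * Local cohomology from Ext(k, M) *)

Section LocalCohomologySupport.
Variable B : grRing.

Definition killed_by_tail (n : nat) (M : grMod B) (y : M) : Prop :=
  forall a : B, tail n a -> a *: y = 0.

Lemma tail_sub m n (a : B) : (m <= n)%N -> tail n a -> tail m a.
Proof.
move=> mn /tailP h; apply/tailP => j jm; apply: h.
by apply: lt_le_trans jm _; rewrite lez_nat.
Qed.

Lemma tail_homog n j (a : B) : grR j a -> n%:Z <= j -> tail n a.
Proof. by move=> ga nj; apply: gsum1 nj ga. Qed.

Lemma killed_sub m n (M : grMod B) (y : M) : (m <= n)%N ->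
  killed_by_tail m y -> killed_by_tail n y.
Proof. by move=> mn h a /(tail_sub mn)/h. Qed.

Lemma killedD n (M : grMod B) (y z : M) :
  killed_by_tail n y -> killed_by_tail n z -> killed_by_tail n (y + z).
Proof. by move=> hy hz a ta; rewrite scalerDr hy // hz // addr0. Qed.

Lemma killed0 n (M : grMod B) : killed_by_tail n (0 : M).
Proof. by move=> a _; rewrite scaler0. Qed.

Lemma trunc_1E n (q : trunc B n) :
  q = repr (q : tquot B n) *: (tpi n 1 : trunc B n).
Proof. by rewrite [RHS]tscale_pi mulr1 tpi_repr. Qed.

Lemma trunc_map_lin n (M : grMod B) (y : M) (hy : killed_by_tail n y) :
  linear (fun q : trunc B n => repr (q : tquot B n) *: y).
Proof.
move=> a p q; rewrite scalerA -scalerDl; apply/eqP.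
rewrite -subr_eq0 -scalerBl; apply/eqP/hy/tpi_eq.
by rewrite tpiD tpi_repr -tscale_pi !tpi_repr.
Qed.

Definition trunc_map n (M : grMod B) (y : M) (hy : killed_by_tail n y) :
  {linear trunc B n -> M} := mklin (trunc_map_lin hy).

Lemma trunc_mapE n (M : grMod B) (y : M) (hy : killed_by_tail n y) a :
  trunc_map hy (tpi n a : trunc B n) = a *: y.
Proof.
apply/eqP; rewrite -subr_eq0 -[trunc_map _ _]/(repr (tpi n a) *: y) -scalerBl.
by apply/eqP/hy/tpi_eq; rewrite tpi_repr.
Qed.

Lemma trunc_map_deg n (M : grMod B) (y : M) (hy : killed_by_tail n y) j :
  grM j y -> homdeg j (trunc_map hy).
Proof.
by move=> gy i _ [a ga ->]; rewrite trunc_mapE; apply: grM_Z.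
Qed.

Lemma trunc_lin_tpi n (M : grMod B) (f : {linear trunc B n -> M}) a :
  f (tpi n a : trunc B n) = a *: f (tpi n 1 : trunc B n).
Proof. by rewrite -linearZ /=; congr (f _); rewrite [RHS]tscale_pi mulr1. Qed.

Lemma trunc_1_killed n (M : grMod B) (f : {linear trunc B n -> M}) :
  killed_by_tail n (f (tpi n 1 : trunc B n)).
Proof.
move=> a ta; rewrite -trunc_lin_tpi -[RHS](linear0 f); congr (f _).
by rewrite -(@tpi0 B n); apply/tpi_eq; rewrite subr0.
Qed.

Lemma trunc_1_deg n (M : grMod B) (f : {linear trunc B n -> M}) j :
  homdeg j f -> grM j (f (tpi n 1 : trunc B n)).
Proof.
by move=> df; rewrite -[j]add0r; apply: df; exists 1 => //; apply: grR_1.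
Qed.

Variables (hB : deg0_division B) (hN : left_noetherian B).
Variables (M : grMod B) (I : injres M).

(* Evaluation at the class of 1 identifies Hom(B/B_{>=n}, I_q) with the elements
   of I_q killed by B_{>=n}. *)
Definition bnd (n q : nat) (j : int) : I q -> Prop :=
  match q with
  | 0 => fun y => y = 0
  | q'.+1 => fun y => exists z : I q',
      [/\ grM j z, killed_by_tail n z & y = ird I q' z]
  end.

Lemma ird_ird q x : ird I q.+1 (ird I q x) = 0.
Proof. by apply/(ir_exactS (i := I)); exists x. Qed.

Lemma bnd_cocycle n q j (y : I q) : bnd n j y -> ird I q y = 0.
Proof.
case: q y => [|q] y /=; first by move=> ->; rewrite linear0.
by move=> [z [_ _ ->]]; apply: ird_ird.
Qed.

Lemma bnd0 n q j : bnd n j (0 : I q).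
Proof.
case: q => [//|q] /=; exists 0; rewrite linear0; split=> //.
  exact: (ds0 (grM_ds _)).
exact: killed0.
Qed.

Lemma bndD n q j (y z : I q) : bnd n j y -> bnd n j z -> bnd n j (y + z).
Proof.
case: q y z => [|q] y z /=; first by move=> -> ->; rewrite addr0.
move=> [y' [gy ky ->]] [z' [gz kz ->]]; exists (y' + z'); rewrite linearD.
by split=> //; [apply: (dsD (grM_ds _))|apply: killedD].
Qed.

Lemma bnd_sub m n q j (y : I q) : (m <= n)%N -> bnd m j y -> bnd n j y.
Proof.
case: q y => [|q] y //= mn [z [gz kz ->]]; exists z; split=> //.
exact: killed_sub kz.
Qed.

Lemma bnd_deg n q j (y : I q) : bnd n j y -> grM j y.
Proof.
case: q y => [|q] y /=; first by move=> ->; apply: (ds0 (grM_ds _)).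
by move=> [z [gz _ ->]]; have := ird_deg (i := I) gz; rewrite addr0.
Qed.

(** Linearity enters only as the hypothesis on [f], since the lemma is also applied to composites
    with [trunc_proj], which are bare functions. *)
Lemma ext_B_bnd n q j (f : trunc B n -> I q) :
  (forall a, f (tpi n a) = a *: f (tpi n 1)) ->
  ext_B j f <-> bnd n j (f (tpi n 1)).
Proof.
case: q f => [|q] f fE /=; split=> [h|h].
- exact: h.
- by move=> x; rewrite -[x](@tpi_repr B n) fE h scaler0.
- have [g [dg gE]] := h; exists (g (tpi n 1)).
  by split=> //; [apply: trunc_1_deg|apply: trunc_1_killed].
have [z [gz kz ez]] := h; exists (trunc_map kz); split.
  exact: trunc_map_deg.
by move=> x; rewrite -[x](@tpi_repr B n) fE trunc_mapE linearZ /= ez.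
Qed.

Lemma ext_zeroP n q j : ext_zero (trunc B n) I q j <->
  forall y : I q, grM j y -> killed_by_tail n y -> ird I q y = 0 -> bnd n j y.
Proof.
split=> [h y gy ky zy|h f [df zf]].
  have := h (trunc_map ky).
  rewrite (@ext_B_bnd n q j (trunc_map ky)); last first.
    by move=> a; apply: trunc_lin_tpi.
  rewrite trunc_mapE scale1r; apply; split; first exact: trunc_map_deg.
  by move=> x; rewrite -[x](@tpi_repr B n) trunc_mapE linearZ /= zy scaler0.
apply/(@ext_B_bnd n q j f); first exact: trunc_lin_tpi.
by apply: h; [apply: trunc_1_deg|apply: trunc_1_killed|apply: zf].
Qed.

Lemma lcoh_suppP q j : lcoh_supp I q j <->
  exists n (y : I q), [/\ grM j y, killed_by_tail n y, ird I q y = 0 &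
    forall n', (n <= n')%N -> ~ bnd n' j y].
Proof.
have projE n n' q' (f : {linear trunc B n -> I q'}) : (n <= n')%N -> forall a,
    (f \o @trunc_proj B n n') (tpi n' a) = a *: f (tpi n 1).
  by move=> nn' a; rewrite /= trunc_projE // trunc_lin_tpi.
split=> [[n [f [[df zf] hf]]]|[n [y [gy ky zy hy]]]].
  exists n, (f (tpi n 1)); split.
  - exact: trunc_1_deg.
  - exact: trunc_1_killed.
  - exact: zf.
  move=> n' nn'; have := hf n' nn'; rewrite ext_B_bnd projE ?scale1r //.
  by move=> a; rewrite !projE // scale1r.
exists n, (trunc_map ky); split.
  split; first exact: trunc_map_deg.
  by move=> x; rewrite -[x](@tpi_repr B n) trunc_mapE linearZ /= zy scaler0.
move=> n' nn'; have := hy n' nn'; rewrite ext_B_bnd.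
  by rewrite projE // trunc_mapE !scale1r.
by move=> a; rewrite !projE // trunc_mapE !scale1r.
Qed.

Lemma tail_gsub_cmp n j (x : regular B) :
  tail n (x : B) -> tail n (mcmp j x : B).
Proof.
move=> /tailP h; apply/tailP => i ni; rewrite /rcmp.
rewrite (cmp_homog _ _ (mcmp_in j x : grR j _)); case: eqP => // <-.
exact: h.
Qed.

Definition tail_gsub (n : nat) : gsubmod (regular B).
Proof.
exists (fun x => tail n (x : B)).
- exact: gsum0.
- move=> a x y tx ty; apply: (gsumD (grR_ds B)) => //; exact: tailM.
- exact: tail_gsub_cmp.
Defined.

(* Modulo boundaries, a cochain killed by B_{>=n+1} whose differential is killed
   by B_{>=n} can be made to be killed by B_{>=n}: a minimal generator u of
   B_{>=n} of degree n sends it to a cocycle of Hom(k, I), hence to a boundary,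
   and the relations between minimal generators impose no condition on the
   choice of the corresponding cochains. *)
Lemma killed_descent n q j (z : I q) :
  ext_zero (kmod B) I q (j + n%:Z) -> grM j z ->
  killed_by_tail n.+1 z -> killed_by_tail n (ird I q z) ->
  exists w : I q, bnd n.+1 j w /\ killed_by_tail n (z - w).
Proof.
move=> /ext_zeroP hk gz kz kdz.
have fgT : fg_sub (tail_gsub n).
  by apply: hN; [apply: gs_0|apply: (@gs_lin _ _ (tail_gsub n))].
have [r [e [u [hu umin]]]] := minimal_hom_gens hB fgT.
have [tu gu su] := hu.
have uz_hi i : e i <> n%:Z -> tail n.+1 (u i : B).
  move=> en; apply/tailP => m; rewrite -[n.+1%:Z]/(1 + n%:Z) => mn.
  rewrite /rcmp (cmp_homog _ _ (gu i)); case: eqP => // em.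
  have mn' : m < n%:Z.
    by rewrite lt_neqAle -ltzD1 addrC mn andbT em; apply/eqP.
  have /tailP/(_ m mn') := tu i; rewrite /rcmp (cmp_homog _ _ (gu i)).
  by rewrite em eqxx.
have uz_lo i : e i = n%:Z -> bnd 1 (j + n%:Z) ((u i : B) *: z).
  move=> en; apply: hk.
  - by rewrite addrC -en; apply: grM_Z => //; apply: gu.
  - move=> a /tail1P a0; rewrite scalerA; apply: kz; apply/tailP => m.
    rewrite -[n.+1%:Z]/(1 + n%:Z) addrC ltzD1 => mn.
    have := mcmpZ m a (gu i).
    rewrite -[mcmp _ _]/(rcmp m (a * (u i : B))) => ->.
    rewrite en; have : m - n%:Z <= 0 by rewrite subr_le0.
    rewrite le_eqVlt => /orP[/eqP->|/rcmp_neg->]; first by rewrite a0 scale0r.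
    by rewrite scale0r.
  - by rewrite linearZ /=; apply: kdz; apply: tu.
have killed_gens (y : I q) :
    (forall i, (u i : B) *: y = 0) -> killed_by_tail n y.
  move=> uy a /su[c ->]; rewrite scaler_suml big1 // => i _.
  by rewrite -scalerA uy scaler0.
case: q z hk gz kz kdz uz_lo killed_gens =>
  [|q] z hk gz kz kdz uz_lo killed_gens.
  exists 0; split=> //; rewrite subr0; apply: killed_gens => i.
  have [/uz_lo//|/eqP/uz_hi/kz//] := eqVneq (e i) n%:Z.
have /choice[y yP] : forall i, exists y : I q, [/\ grM (e i + j) y,
    killed_by_tail 1 y, (u i : B) *: z = ird I q y & e i <> n%:Z -> y = 0].
  move=> i; have [en|/eqP en] := eqVneq (e i) n%:Z.
    by have [y [gy ky ey]] := uz_lo i en; exists y; rewrite en addrC; split.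
  exists 0; split=> //; [exact: (ds0 (grM_ds _))|exact: killed0|].
  by rewrite linear0 kz //; apply: uz_hi.
have dy : homdeg j (frmap e y) by apply: frmap_deg => i; case: (yP i).
have du : homdeg 0 (frmap e u).
  by apply: frmap_deg => i; rewrite addr0; apply: gu.
have [|g [dg gE]] := inj_ext (@ir_inj _ _ I q) du dy.
  move=> x /(umin (fun i => x i)) x0; rewrite frmapE big1 // => i _.
  by have [_ ky _ _] := yP i; apply: ky; apply/tail1P.
have gu_y i : g (u i) = y i by rewrite -(frmap_e e u i) gE frmap_e.
pose w := g (1 : regular B).
have wE (a : B) : a *: w = g (a : regular B).
  by rewrite -linearZ /= [a *: _]mulr1.
exists (ird I q w); split.
  exists w; split=> //.
    by rewrite -[j]add0r; apply: dg; apply: grR_1.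
  (* In degrees at least n+1, the coefficients on generators of degree n have positive degree and
     kill [y i]; for the other generators [y i] is zero. *)
  move=> a /tailP ta; rewrite wE.
  have [s us ->] := sum_cmp (grM_ds (regular B)) (a : regular B).
  rewrite linear_sum big1 // => m _; rewrite -/(mcmp _ _).
  have [mn|mn] := ltP m n.+1%:Z.
    by rewrite [mcmp _ _](ta m mn) linear0.
  have Sm : tail_gsub n (mcmp m (a : regular B)).
    by apply: (tail_homog (rcmp_in m a)); apply: le_trans mn; rewrite lez_nat.
  have [c [gc ->]] := hom_gens_coef hu Sm (mcmp_in m (a : regular B)).
  rewrite linear_sum big1 // => i _; rewrite linearZ /= gu_y.
  have [_ ky _ y0] := yP i.
  have [en|/eqP/y0->] := eqVneq (e i) n%:Z; last exact: scaler0.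
  apply: ky; apply: (tail_homog (gc i)); rewrite en lerBrDr.
  by apply: le_trans mn; rewrite -PoszD.
apply: killed_gens => i; have [_ _ ey _] := yP i.
by rewrite scalerBr ey -linearZ /= wE gu_y subrr.
Qed.

(** If Ext^q(k, M) vanished in all degrees from [j] on, [killed_descent] would lower the stage of a
    cocycle, modulo boundaries, down to 0, where it is killed by 1. *)
Lemma lcoh_supp_ext q j : lcoh_supp I q j ->
  exists m : nat, ~ ext_zero (kmod B) I q (j + m%:Z).
Proof.
move=> /lcoh_suppP[n [y [gy ky zy hy]]]; apply: contrapT => hm.
have {}hm m : ext_zero (kmod B) I q (j + m%:Z).
  by apply: contrapT => h; apply: hm; exists m.
apply: (hy n) => //; elim: n y gy ky zy {hy} => [|n IH] y gy ky zy.
  have -> : y = 0; last exact: bnd0.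
  rewrite -[y]scale1r; apply: ky; apply: (tail_homog (@grR_1 B)).
  by [].
have [|w [bw kw]] := killed_descent (hm n) gy ky.
  by rewrite zy; apply: killed0.
rewrite -[y](subrK w); apply: bndD => //; apply: (bnd_sub (leqnSn n)).
apply: IH => //; last by rewrite linearB /= zy (bnd_cocycle bw) subr0.
by apply: (dsB (grM_ds _)) => //; apply: bnd_deg bw.
Qed.

(** A nonzero class of Ext^q(k, M) lives at stage 1. If it bounds [z] at a later stage,
    [killed_descent] applied to [z] lowers that stage one by one to 1, a contradiction; the steps
    stop at stage 1, hence only [0 < m] occurs. *)
Lemma ext_lcoh_supp q j : ~ ext_zero (kmod B) I q j ->
  (forall q' m, q = q'.+1 -> (0 < m)%N -> ext_zero (kmod B) I q' (j + m%:Z)) ->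
  lcoh_supp I q j.
Proof.
move=> hq hq'; apply/lcoh_suppP; apply: contrapT => hn; apply: hq.
apply/ext_zeroP => y gy ky zy; apply: contrapT => nb; apply: hn.
exists 1%N, y; split=> // n n1 b; apply: nb.
elim: n n1 b => // n IH _; case: (posnP n) => [->//|n0] b.
apply: IH => //.
case: q y gy ky zy hq' b => [//|q] y gy ky zy hq' [z [gz kz ez]].
have [||w [bw kw]] := killed_descent _ gz kz.
- exact: hq'.
- by rewrite -ez; apply: killed_sub ky.
exists (z - w); split=> //; last by rewrite linearB /= (bnd_cocycle bw) subr0.
by apply: (dsB (grM_ds _)) => //; apply: bnd_deg bw.
Qed.

End LocalCohomologySupport.

(** * Degrees of Tor and local cohomology *)

Section Core.
Variables (B : grRing) (hB : deg0_division B) (hN : left_noetherian B).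
Variables (M : grMod B) (hfg : fin_gen M) (hpd : finite_projdim M).

Lemma kmod_fin_gen : fin_gen (kmod B).
Proof.
exists 1%N, (fun=> tpi 1 1 : kmod B); split=> // x _.
exists (fun=> repr (x : tquot B 1)); rewrite big_ord1.
exact: trunc_1E.
Qed.

Lemma trivial_tor_supp (N : grMod (grop B)) (P : projres M) i j :
  trivial_mod (P i) -> ~ tor_supp N P i j.
Proof.
move=> P0 [s _]; apply; exists [::] => // V b hb.
by rewrite big_nil big1 // => u _; rewrite [u.2]P0 (balanced0r _ hb).
Qed.

Lemma tor_supp_gens (F : minres M) (P : projres M) i j :
  tor_supp (kmod (grop B)) P i j <-> exists k, @mr_b _ _ F i k = j.
Proof. by rewrite -tor_supp_minres; split; apply: tor_supp_sub. Qed.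

(** Tor can be computed from a resolution of finite length, so it vanishes in large index, and Tor
    counts the generators of [F]. *)
Lemma minres_bounded (F : minres M) :
  exists n, forall i, (n < i)%N -> 'I_(mr_n F i) -> False.
Proof.
have [n [[P Pn] _]] := hpd; exists n => i ni k.
apply: (@trivial_tor_supp (kmod (grop B)) P i (mr_b k)); first exact: Pn.
by apply/(tor_supp_gens F); exists k.
Qed.

Variables (d : nat) (l : int) (J : injres (regular B)).
Hypothesis (hJ0 : forall q j, (q, j) <> (d, - l) -> ext_zero (kmod B) J q j).
Hypothesis (hJ1 : ~ ext_zero (kmod B) J d (- l)).
Variables (I : injres M) (F : minres M).

Lemma ext_zero_gens q j : ext_zero (kmod B) I q j <->
  forall i, (q + i = d)%N -> forall k, @mr_b _ _ F i k <> j + l.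
Proof.
have [G] := minres_exists hB hN kmod_fin_gen.
have [n hn] := minres_bounded F.
rewrite (ext_zero_hvan (minres_projres G)); apply: (hvan_minres _ _ hn).
  by move=> a i ne; apply/(ext_zero_hvan _ J)/hJ0.
by move/(ext_zero_hvan _ J).
Qed.

Lemma gens_length i : 'I_(mr_n F i) -> (i <= d)%N.
Proof.
have [G] := minres_exists hB hN kmod_fin_gen.
have [n hn] := minres_bounded F.
apply: (@minres_length _ _ _ (minres_projres G) F d l n) => //.
  by move=> a j ne; apply/(ext_zero_hvan _ J)/hJ0.
by move/(ext_zero_hvan _ J).
Qed.

Lemma lcoh_supp_le q j : lcoh_supp I q j ->
  exists i k, (q + i = d)%N /\ j <= @mr_b _ _ F i k - l.
Proof.
move=> /(lcoh_supp_ext hB hN)[m]; rewrite ext_zero_gens => h.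
apply: contrapT => h'; apply: h => i qi k e; apply: h'; exists i, k; split=> //.
by rewrite e addrK lerDl.
Qed.

(* The obstruction to surviving in the colimit lies in Ext^(q-1)(k, M), in
   degrees greater than [mr_b k - l], where it vanishes by [ext_zero_gens]. *)
Lemma gens_lcoh_supp q i k : (q + i = d)%N ->
  (forall k', @mr_b _ _ F i.+1 k' <= @mr_b _ _ F i k) ->
  lcoh_supp I q (@mr_b _ _ F i k - l).
Proof.
move=> qi hk; apply: (ext_lcoh_supp hB hN).
  by move/ext_zero_gens => /(_ i qi k); rewrite subrK.
move=> q' m eq m0; apply/ext_zero_gens => i' qi' k' e.
have ei : i' = i.+1 by apply/eqP; rewrite -(eqn_add2l q') addnS qi' -qi eq.
move: ei k' e => -> k' e; have := hk k'.
by rewrite e addrAC subrK gerDl leNgt ltz_nat m0.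
Qed.

(** Induction on d-i: either the generator survives in the colimit, or a generator of larger degree
    in the next index replaces it. At [i = d] the condition for survival is vacuous by
    [gens_length]. *)
Lemma gens_lcoh_supp_ge (R : realType) (xi : R) i (k : 'I_(mr_n F i)) :
  xi <= 1 ->
  exists i' k', [/\ (i <= i')%N, (i' <= d)%N,
    lcoh_supp I (d - i') (@mr_b _ _ F i' k' - l) &
    (mr_b k)%:~R - xi * i%:R <= (@mr_b _ _ F i' k')%:~R - xi * i'%:R].
Proof.
move=> xi1; have id := gens_length k.
have [m em] : exists m, (i + m = d)%N by exists (d - i)%N; apply: subnKC.
elim: m i k em {id} => [|m IH] i k em.
  exists i, k; split=> //; first by rewrite -em addn0.
  apply: gens_lcoh_supp; first by rewrite subnK // -em addn0.
  by move=> k'; have := gens_length k'; rewrite -em addn0 ltnn.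
have [h|] := pselect (forall k', @mr_b _ _ F i.+1 k' <= mr_b k).
  exists i, k; split=> //; first by rewrite -em leq_addr.
  by apply: gens_lcoh_supp => //; rewrite subnK // -em leq_addr.
move=> /existsNP[k' /negP]; rewrite -ltNge => kk'.
have [|i2 [k2 [ii2 i2d lc le2]]] := IH i.+1 k'; first by rewrite addSnnS.
exists i2, k2; split=> //; first exact: ltnW.
(* Integer degrees that differ do so by at least 1, which is at least [xi]. *)
apply: le_trans le2; rewrite -[i.+1%:R]natr1 mulrDr mulr1 opprD addrA addrAC.
rewrite lerD2r lerBrDr -lezD1 in kk' *.
apply: (@le_trans _ _ ((mr_b k + 1)%:~R)); rewrite ?ler_int //.
by rewrite rmorphD lerD2l.
Qed.

Section Regularity.
Variables (P : projres M) (R : realType) (xi : R).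
Hypothesis xi1 : xi <= 1.
Local Notation N := (kmod (grop B)).

Lemma gdeg_le (S : set int) (c : R) (y : \bar R) :
  (forall j, S j -> ((j%:~R + c)%:E <= y)%E) -> (gdeg R S + c%:E <= y)%E.
Proof.
move=> h; rewrite -leeBrDr //; apply: ge_ereal_sup => _ [j Sj <-].
by rewrite leeBrDr // -EFinD; apply: h.
Qed.

Lemma le_gdeg (S : set int) (c : R) j : S j ->
  ((j%:~R + c)%:E <= gdeg R S + c%:E)%E.
Proof.
by move=> Sj; rewrite EFinD leeD2r //; apply: ereal_sup_ubound; exists j.
Qed.

Let Tmax w := (\big[maxe/-oo%E]_(d - w <= j < d.+1)
  (gdeg R (tor_supp N P j) - (xi * j%:R)%:E))%E.

Lemma Tmax_le w y :
  (forall i (k : 'I_(mr_n F i)), (d - w <= i)%N -> (i <= d)%N ->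
    ((- l%:~R + xi * d%:R + ((mr_b k)%:~R - xi * i%:R))%:E <= y)%E) ->
  ((- l%:~R + xi * d%:R)%:E + Tmax w <= y)%E.
Proof.
move=> h; rewrite addeC -leeBrDr //.
rewrite /Tmax big_seq_cond; apply: bigmax_le; first exact: leNye.
move=> i /andP[]; rewrite mem_index_iota ltnS => /andP[wi id] _.
rewrite -EFinN; apply: gdeg_le => j /(tor_supp_gens F)[k <-].
by rewrite leeBrDr // -EFinD addrC; apply: h.
Qed.

Lemma le_Tmax w i (k : 'I_(mr_n F i)) : (d - w <= i)%N -> (i <= d)%N ->
  ((- l%:~R + xi * d%:R + ((mr_b k)%:~R - xi * i%:R))%:E <=
   (- l%:~R + xi * d%:R)%:E + Tmax w)%E.
Proof.
move=> wi id; rewrite EFinD leeD2l //.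
apply: (@le_trans _ _ (gdeg R (tor_supp N P i) - (xi * i%:R)%:E)%E).
  by rewrite -EFinN; apply: le_gdeg; apply/(tor_supp_gens F); exists k.
apply: (le_bigmax_seq _ i xpredT
  (fun i => (gdeg R (tor_supp N P i) - (xi * i%:R)%:E)%E)) => //.
by rewrite mem_index_iota wi ltnS.
Qed.

(** The contribution of one generator to the right-hand side; it equals t + xi q for t = b - l and q
    = d - i. *)
Let value i (k : 'I_(mr_n F i)) : R :=
  - l%:~R + xi * d%:R + ((mr_b k)%:~R - xi * i%:R).

Lemma lcoh_value_le q t : lcoh_supp I q t ->
  exists i k, (q + i = d)%N /\ t%:~R + xi * q%:R <= @value i k.
Proof.
move=> /lcoh_supp_le[i [k [qi tle]]]; exists i, k; split=> //.
have /= : t%:~R <= (mr_b k - l)%:~R :> R by rewrite ler_int.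
by rewrite /value -qi natrD rmorphB /=; lra.
Qed.

(** The index only grows on the way from [i] to d-q; the resulting bound [q + i <= d] keeps [q] at
    most [w] when [i] is at least d-w. *)
Lemma value_le_lcoh i k : exists q t,
  [/\ lcoh_supp I q t, (q + i <= d)%N & @value i k <= t%:~R + xi * q%:R].
Proof.
have [i' [k' [ii' id lc le]]] := gens_lcoh_supp_ge k xi1.
exists (d - i')%N, (mr_b k' - l); split=> //.
  by rewrite -{2}(subnK id) leq_add2l.
by rewrite /value natrB // rmorphB /=; lra.
Qed.

Lemma max_lcoh_eq w : (w <= d)%N ->
  \big[maxe/-oo%E]_(0 <= j < w.+1) (gdeg R (lcoh_supp I j) + (xi * j%:R)%:E)%E
  = ((- l%:~R + xi * d%:R)%:E + Tmax w)%E.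
Proof.
move=> wd; apply/le_anti/andP; split.
  rewrite big_seq_cond; apply: bigmax_le; first exact: leNye.
  move=> q /andP[]; rewrite mem_index_iota ltnS /= => qw _.
  apply: gdeg_le => t /lcoh_value_le[i [k [qi tle]]].
  apply: (@le_trans _ _ (value k)%:E); first by rewrite lee_fin.
  apply: le_Tmax; last by rewrite -qi leq_addl.
  by rewrite leq_subLR -qi leq_add2r.
apply: Tmax_le => i k wi id; have [q [t [lc qi le]]] := value_le_lcoh k.
apply: (@le_trans _ _ (t%:~R + xi * q%:R)%:E); first by rewrite lee_fin.
apply: (le_trans (le_gdeg _ lc)).
apply: (le_bigmax_seq _ q xpredT
  (fun q => (gdeg R (lcoh_supp I q) + (xi * q%:R)%:E)%E)) => //.
rewrite mem_index_iota ltnS /= -(leq_add2r i); apply: leq_trans qi _.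
by rewrite -leq_subLR.
Qed.

Lemma CMreg_le y : (forall q t, lcoh_supp I q t ->
  ((t%:~R + xi * q%:R)%:E <= y)%E) -> (CMreg I xi <= y)%E.
Proof. by move=> h; apply: ge_ereal_sup => _ [[q t] /= lc <-]; apply: h. Qed.

Lemma le_CMreg q t : lcoh_supp I q t ->
  ((t%:~R + xi * q%:R)%:E <= CMreg I xi)%E.
Proof. by move=> lc; apply: ereal_sup_ubound; exists (q, t). Qed.

Lemma CMreg_eq w : (forall i, lcoh_supp I i !=set0 -> (i <= w)%N) ->
  CMreg I xi = ((- l%:~R + xi * d%:R)%:E + Tmax w)%E.
Proof.
move=> hw; apply/le_anti/andP; split.
  apply: CMreg_le => q t lc; have [i [k [qi tle]]] := lcoh_value_le lc.
  apply: (@le_trans _ _ (value k)%:E); first by rewrite lee_fin.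
  apply: le_Tmax; last by rewrite -qi leq_addl.
  by rewrite leq_subLR -qi leq_add2r; apply: hw; exists t.
apply: Tmax_le => i k _ _; have [q [t [lc _ le]]] := value_le_lcoh k.
by apply: le_trans (le_CMreg lc); rewrite lee_fin.
Qed.

(** Every generator of [F_i] yields local cohomology in some degree q with q+i at most [d]. Here q
    must be [s], so [F] stops at d-s, and the nonzero H^s forces a generator at d-s. *)
Lemma cohen_macaulay_eq s : cohen_macaulay I s ->
  [/\ (s <= d)%N, projdim M (d - s) & CMreg I xi
    = ((- l%:~R + xi * s%:R)%:E + gdeg R (tor_supp N P (d - s)))%E].
Proof.
move=> [CM0 [t lct]].
have CMs q u : lcoh_supp I q u -> q = s.
  by move=> lc; apply: contrapT => /CM0 e; move: lc; rewrite e.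
have [i0 [k0 [si0 _]]] := lcoh_value_le lct.
have sd : (s <= d)%N by rewrite -si0 leq_addr.
have ei0 : i0 = (d - s)%N by rewrite -si0 addKn.
subst i0; split=> //.
  split.
    exists (minres_projres F) => i si x; apply/ffunP => k.
    have [q [u [/CMs-> qi _]]] := value_le_lcoh k.
    by move: si; rewrite ltnNge -(leq_add2l s) subnKC // qi.
  (* A shorter resolution would make Tor vanish at d-s, where the generator [k0] shows that it does
     not. *)
  move=> P' n Pn; rewrite leqNgt; apply/negP => nds.
  apply: (@trivial_tor_supp N P' (d - s) (mr_b k0)); first exact: Pn.
  by apply/(tor_supp_gens F); exists k0.
apply/le_anti/andP; split.
  apply: CMreg_le => q u lc; have eq := CMs _ _ lc; subst q.
  have [i [k [si le]]] := lcoh_value_le lc.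
  have ei : i = (d - s)%N by rewrite -si addKn.
  subst i; apply: (@le_trans _ _ (value k)%:E); first by rewrite lee_fin.
  rewrite addeC.
  apply: le_trans (le_gdeg _ (_ : tor_supp N P (d - s) (mr_b k))).
    by rewrite lee_fin /value natrB //; lra.
  by apply/(tor_supp_gens F); exists k.
rewrite addeC; apply: gdeg_le => j /(tor_supp_gens F)[k <-].
have [q [u [lc _ le]]] := value_le_lcoh k; have eq := CMs _ _ lc; subst q.
apply: le_trans (le_CMreg lc); rewrite lee_fin; apply: le_trans le.
by rewrite /value natrB //; lra.
Qed.

End Regularity.

End Core.

Theorem theorem0p8 (k : fieldType) (A : cgAlg k) (d : nat) (l : int)
    (R : realType) (xi : R) (M : grMod (lring A))
    (P : projres M) (I : injres M)
    (hA : noetherian A) (hG : AS_gorenstein A d l) (hxi : xi <= 1)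
    (hM : exists x : M, x != 0) (hfg : fin_gen M) (hpd : finite_projdim M) :
  [/\ (forall w : nat, (w <= d)%N ->
         \big[maxe/-oo%E]_(0 <= j < w.+1)
            (gdeg R (lcoh_supp I j) + (xi * j%:R)%:E)%E
         = ((- l%:~R + xi * d%:R)%:E
            + \big[maxe/-oo%E]_(d - w <= j < d.+1)
                 (gdeg R (tor_supp (kmod (rring A)) P j) - (xi * j%:R)%:E))%E),
      (forall w : nat, lcoh_supp I w !=set0 ->
         (forall i : nat, lcoh_supp I i !=set0 -> (i <= w)%N) ->
         CMreg I xi
         = ((- l%:~R + xi * d%:R)%:E
            + \big[maxe/-oo%E]_(d - w <= j < d.+1)
                 (gdeg R (tor_supp (kmod (rring A)) P j) - (xi * j%:R)%:E))%E)
    & (forall s : nat, cohen_macaulay I s ->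
         [/\ (s <= d)%N,
             projdim M (d - s)
           & CMreg I xi
             = ((- l%:~R + xi * s%:R)%:E + gdeg R (tor_supp (kmod (rring A)) P (d - s)))%E])].
Proof.
(* Nonzero elements of degree 0 are nonzero scalars, since A_0 = k. *)
have hB : deg0_division (lring A).
  move=> c; rewrite /= grA_0 => -[a _ <-] a0; exists (a^-1%:A : A).
  rewrite -[LHS]/((a^-1%:A : A) * a%:A) -scalerAl mul1r scalerA.
  rewrite mulVf ?scale1r //.
  by apply: contraNneq a0 => ->; rewrite scale0r.
have hN := hA.1; have [[[[J _] _] hJ] _] := hG; have [hJ0 hJl] := hJ J.
have h0 q j : (q, j) <> (d, - l) -> ext_zero (kmod (lring A)) J q j.
  have [->|/eqP qd] := eqVneq q d; last by move=> _; apply: hJ0.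
  by have := hJl j; case: ifP => [|_ //]; rewrite addr_eq0 => /eqP ->.
(* A cocycle that [phi] sends to 1 cannot be a coboundary, as coboundaries go to 0. *)
have h1 : ~ ext_zero (kmod (lring A)) J d (- l).
  have := hJl (- l); rewrite addNr eqxx => -[phi [_ surj ker]] hz.
  have [f fZ f1] := surj 1; have := (ker f fZ).2 (hz f fZ).
  by rewrite f1 => /eqP; rewrite oner_eq0.
have [F] := minres_exists hB hN hfg.
split.
- exact: (max_lcoh_eq hB hN hpd h0 h1 I F P hxi).
- by move=> w _; apply: (CMreg_eq hB hN hpd h0 h1 F P hxi).
- by move=> s; apply: (cohen_macaulay_eq hB hN hpd h0 h1 F P hxi).
Qed.
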